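(* Suppose $f\colon X\to Y$ is a perfect map between metrizable spaces with $\dim f\le n$ and $\dim Y\le 0$. Then $C^*(X,\mathbb{R}^m)$ (with the source limitation topology) contains a dense $G_\delta$-subset $\mathcal{K}$ of maps $g$ such that, for any integers $d,t,T$ with $0\le t\le d\le T\le m$ and $d\le m-n-1$ and any $d$-plane $\Pi^d\subset\mathbb{R}^m$ parallel to some coordinate planes $\Pi^t\subset\Pi^T\subset\mathbb{R}^m$, each set $f^{-1}(y)\cap g^{-1}(\Pi^d)$, $y\in Y$, has at most $q$ points, where $$q=d+1-t+\frac{n+(n+T-m)(d-t)}{m-n-d}\quad\text{if } n\ge (m-n-T)(d-t),$$ and $$q=1+\frac{n}{m-n-T}\quad\text{otherwise.}$$
   Context: All maps are continuous. $n\ge 0$ and $m\geq 1$ are integers. $\dim$ is covering dimension, and $\dim f=\sup\{\dim f^{-1}(y):y\in Y\}$. A perfect map is a closed continuous map with compact fibers. A $k$-plane in $\mathbb{R}^m$ is a $k$-dimensional affine (not necessarily coordinate) plane; a coordinate $k$-plane is the linear span of $k$ of the standard unit coordinate vectors. For $t\le d\le T$, a $d$-plane $\Pi^d$ is parallel to coordinate planes $\Pi^t\subset\Pi^T$ if its direction space $V$ (the linear subspace of which $\Pi^d$ is a translate) satisfies $\Pi^t\subset V\subset\Pi^T$. $C^*(X,\mathbb{R}^m)$ is the set of all bounded continuous maps $X\to\mathbb{R}^m$. Source limitation topology: with $\varrho$ the Euclidean metric, a set $U\subset C^*(X,\mathbb{R}^m)$ is open iff for every $g\in U$ there is a continuous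 function $\alpha\colon X\to(0,\infty)$ such that $\{h\in C^*(X,\mathbb{R}^m):\varrho(g(x),h(x))\le\alpha(x)\text{ for each }x\in X\}\subset U$. *)

(* Defs.v *)
From HB Require Import structures.
From mathcomp Require Import all_boot all_order all_algebra.
From mathcomp Require Import all_classical all_reals all_analysis borel_hierarchy.

Set Implicit Arguments.
Unset Strict Implicit.
Unset Printing Implicit Defensive.

Import Order.TTheory GRing.Theory Num.Theory.
Import numFieldNormedType.Exports.

Local Open Scope classical_set_scope.
Local Open Scope card_scope.
Local Open Scope ring_scope.

Definition metrizable (R : realType) (X : topologicalType) : Prop :=
  exists (M : metricType R) (h : X -> M) (k : M -> X),
    [/\ cancel h k, cancel k h, continuous h & continuous k].

Definition perfect_map (X Y : topologicalType) (f : X -> Y) : Prop :=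
  [/\ continuous f,
      forall C : set X, closed C -> closed (f @` C)
    & forall y : Y, compact (f @^-1` [set y])].

Definition finite_open_cover (X : topologicalType) (C : set (set X)) : Prop :=
  [/\ finite_set C, forall U, C U -> open U & \bigcup_(U in C) U = setT].

(* Covering dimension [dim X <= n]: every finite open cover has a finite open
   refinement of order [<= n], i.e. with no point in more than [n + 1] members.
   In particular the empty space satisfies it for every [n]. *)
Definition dim_le (X : topologicalType) (n : nat) : Prop :=
  forall C : set (set X), finite_open_cover C ->
  exists D : set (set X),
    [/\ finite_open_cover D,
        forall V, D V -> exists2 U, C U & V `<=` U
      & forall x : X, D `&` [set V | V x] #<= `I_n.+1].

(* The fibers carry the topology of [set_type], i.e. the one induced by [X]
   (unlike [subspace A], whose carrier is all of [X]). *)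
Definition map_dim_le (X Y : topologicalType) (f : X -> Y) (n : nat) : Prop :=
  forall y : Y, dim_le (set_type (f @^-1` [set y])) n.

(* The library norm on ['rV[R]_m] is the sup norm. *)
Definition edist (R : realType) (m : nat) (u v : 'rV[R]_m) : R :=
  Num.sqrt (\sum_(i < m) (u ord0 i - v ord0 i) ^+ 2).

Record bcont (R : realType) (X : topologicalType) (m : nat) := BCont {
  bcont_fun :> X -> 'rV[R]_m ;
  bcont_continuous : continuous bcont_fun ;
  bcont_bounded : bounded_fun bcont_fun }.

HB.instance Definition _ (R : realType) (X : topologicalType) (m : nat) :=
  gen_eqMixin (bcont R X m).
HB.instance Definition _ (R : realType) (X : topologicalType) (m : nat) :=
  gen_choiceMixin (bcont R X m).

Section source_limitation_topology.
Variables (R : realType) (X : topologicalType) (m : nat).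
Local Notation C := (bcont R X m).

Definition source_open (U : set C) : Prop :=
  forall g, U g -> exists alpha : X -> R,
    [/\ continuous alpha, forall x, 0 < alpha x
      & [set h : C | forall x, edist (g x) (h x) <= alpha x] `<=` U].

Let source_openT : source_open setT.
Proof.
by move=> g _; exists (cst 1); split=> // x; exact: cst_continuous.
Qed.

Let source_openI : setI_closed source_open.
Proof.
move=> U V Uo Vo g [/Uo[a [ac a0 aU]] /Vo[b [bc b0 bV]]].
exists (fun x => Num.min (a x) (b x)); split=> [x|x|h ghab].
- by apply: continuous_min; [exact: ac|exact: bc].
- by rewrite lt_min a0 b0.
- split; [apply: aU|apply: bV] => x; have := ghab x; rewrite le_min.
  + by case/andP.
  + by case/andP.
Qed.

Let source_open_bigU (I : Type) (F : I -> set C) :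
  (forall i, source_open (F i)) -> source_open (\bigcup_i F i).
Proof.
move=> Fo g [i _ /Fo[a [ac a0 aF]]]; exists a; split=> // h gha.
by exists i => //; exact: aF.
Qed.

HB.instance Definition _ := isOpenTopological.Build C
  source_openT source_openI source_open_bigU.

Lemma source_openE (U : set C) : open U = source_open U.
Proof. by []. Qed.

End source_limitation_topology.

Section planes.
Variables (R : realType) (m : nat).
Implicit Types (V W : {vspace 'rV[R]_m}) (P : set 'rV[R]_m).

Definition has_direction P V : Prop :=
  exists p : 'rV[R]_m, P = [set p + v | v in [set` V]].

Definition is_plane (k : nat) P : Prop :=
  exists2 V, \dim V = k & has_direction P V.

Definition is_coordinate_plane (k : nat) W : Prop :=
  exists2 A : {set 'I_m}, #|A| = k &
    W = <<[seq (delta_mx ord0 i : 'rV[R]_m) | i <- enum A]>>%VS.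

Definition parallel_to P W1 W2 : Prop :=
  exists2 V, has_direction P V & (W1 <= V <= W2)%VS.

End planes.

(* The parameters are cast to [rat] first, so no subtraction is truncated. *)
Definition fiber_bound (m n d t T : nat) : rat :=
  let: (m, n, d, t, T) := (m%:R, n%:R, d%:R, t%:R, T%:R) in
  if (m - n - T) * (d - t) <= n
  then d + 1 - t + (n + (n + T - m) * (d - t)) / (m - n - d)
  else 1 + n / (m - n - T).

Definition at_most (X : Type) (S : set X) (q : rat) : Prop :=
  exists2 k : nat, S #<= `I_k & k%:R <= q.

(* Main.v *)
Require Import Defs.
From HB Require Import structures.
From mathcomp Require Import all_boot all_order all_algebra.
From mathcomp Require Import all_classical all_reals all_analysis borel_hierarchy.
From mathcomp Require Import zify ring lra.
From mathcomp Require wochoice.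

Set Implicit Arguments.
Unset Strict Implicit.
Unset Printing Implicit Defensive.

Import Order.TTheory GRing.Theory Num.Theory.
Import numFieldNormedType.Exports.
Local Open Scope ring_scope.

(** The bound is a count of parameters.  Let [k] points lie on a [d]-plane whose
    direction contains a coordinate [t]-plane and is contained in a coordinate
    [T]-plane.  Such a plane is the graph of an affine map over a set [J] of [d]
    coordinates, so it is given by [m - d] offsets and [(T - d) (d - t)] slopes,
    and each point on it by [d] coordinates.  If moreover each point ranges over
    an [n]-simplex, the configuration as a whole has [k n] barycentric
    parameters; generically it does not exist when
    [k n + k d + (m - d) + (T - d) (d - t) < k m], that is, when [k] exceeds
    [(m - d + (T - d) (d - t)) / (m - n - d)].  This quotient is the first value
    of [q].  When [n < (m - n - T) (d - t)], it is better to enlarge the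
    [d]-plane to a translate of the coordinate [T]-plane, for which the same
    count gives the second value.

    The general position statement is [generic_vertices]: the vertices of a
    complex can be moved slightly so that no [k] points in disjoint simplices
    are [aligned].  It is proved by pigeonhole, in place of a dimension theory
    for semialgebraic sets.  On a grid of mesh [1 / r] there are more positions
    of the vertices than there are values of the parameters rounded to a
    precision of order [1 / r].  If all positions were bad, two different ones
    would share their rounded parameters; but the parameters determine the
    vertices in a Lipschitz way, so that these two would coincide.  The Lipschitz estimate needs bounded slopes, and
    [parallel_chart] provides slopes at most 1 by choosing the coordinates [J]
    of a maximal minor.

    For a fixed combinatorial type and a fixed [eps > 0], call [g] general if no
    [k] points of a fibre of [f] that are [eps] apart are sent to an aligned
    tuple ([general_maps]).  The general maps form an open set
    ([open_general_maps]), since fibres are compact and the slopes range over a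
    compact set.  They are dense ([general_maps_dense]): on one fibre, [g] is
    approximated by a map through the nerve, of dimension at most [n], of a fine
    cover, with vertices in general position, and this approximation stays good
    over a neighbourhood in [Y]; as [dim Y <= 0], the approximations over the different
    neighbourhoods can be glued along a partition into open sets
    ([locally_constant_selection]).  There are countably many types and it is
    enough to take [eps = 1 / (i + 1)], so [source_limitation_baire] yields the
    dense G_delta set. *)

(** * Collisions among grid functions *)

(** The grid functions with a given chart are encoded by their values on the
    coordinates [fixed] by that chart and by one of [K * r] cells for each
    parameter in [I].  With fewer than [#|E|] data in all, there are at most
    [#|C| * K ^ #|I| * r ^ #|E|.-1] codes for [r ^ #|E|] functions. *)
Lemma grid_collision (E I C : finType) (r K : nat)
    (chart : {ffun E -> 'I_r} -> C) (fixed : C -> {set E})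
    (cell : {ffun E -> 'I_r} -> {ffun I -> 'I_(K * r)}) :
  (forall a, #|fixed (chart a)| + #|I| < #|E|)%N ->
  (#|C| * K ^ #|I| < r)%N ->
  exists a a', [/\ a != a', chart a = chart a', cell a = cell a'
                 & {in fixed (chart a), a =1 a'}].
Proof.
move=> few r_big.
have r_gt0 : (0 < r)%N by apply: leq_ltn_trans r_big.
pose P := [exists a, exists a', [&& a != a', chart a == chart a', cell a == cell a'
   & [forall x in fixed (chart a), a x == a' x]]].
have [/existsP[a /existsP[a' /and4P[ne /eqP ec /eqP el /forall_inP fx]]]|noP] :=
  boolP P.
  by exists a, a'; split=> // x xf; apply/eqP/fx.
exfalso.
have sep a a' : chart a = chart a' -> cell a = cell a' ->
    {in fixed (chart a), a =1 a'} -> a = a'.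
  move=> ec el fx; apply/eqP; apply: contraNT noP => ne.
  apply/existsP; exists a; apply/existsP; exists a'; rewrite ne ec el !eqxx /=.
  by apply/forall_inP => x xf; apply/eqP/fx; rewrite ec.
have class_card c : (#|[set a | chart a == c]| <= K ^ #|I| * r ^ #|E|.-1)%N.
  have [->|/finset.set0Pn[a0]] := eqVneq [set a | chart a == c] finset.set0.
    by rewrite cards0.
  rewrite inE => /eqP ca0.
  pose code a := (cell a, [ffun x : {x | x \in fixed c} => a (val x)]).
  have code_inj : {in [set a | chart a == c] &, injective code}.
    move=> a a'; rewrite !inE => /eqP ca /eqP ca' [el /ffunP er].
    apply: sep => // [|x]; first by rewrite ca.
    rewrite ca => xf; have := er (exist _ x xf).
    by rewrite !ffunE.
  rewrite -(card_in_imset code_inj); apply: (leq_trans (max_card _)).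
  rewrite card_prod !card_ffun !card_ord card_sig expnMn -mulnA -expnD.
  apply: leq_mul => //; rewrite leq_pexp2l //.
  have lt_few := few a0; rewrite ca0 in lt_few.
  by rewrite addnC -ltnS prednK // (leq_ltn_trans _ lt_few).
have E_gt0 := leq_ltn_trans (leq0n _) (few [ffun=> Ordinal r_gt0]).
have : (#|{: {ffun E -> 'I_r}}| <= #|C| * (K ^ #|I| * r ^ #|E|.-1))%N.
  rewrite -sum1_card (partition_big chart xpredT) //=.
  rewrite -sum_nat_const; apply: leq_sum => c _.
  apply: leq_trans (class_card c); rewrite -sum1_card.
  by rewrite [leqRHS](eq_bigl (fun a => chart a == c)) // => a; rewrite inE.
rewrite card_ffun card_ord mulnA -{1}(prednK E_gt0) expnS.
by rewrite leq_pmul2r ?expn_gt0 ?r_gt0 // leqNgt r_big.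
Qed.

(** * Vertices in general position *)

(** The points lie on one affine plane, the graph over the coordinates [J] of an
    affine map with linear part [M].  Stating this on differences leaves the
    offsets of the plane out. *)
Definition graph_over (R : realFieldType) (m k : nat) (J : {set 'I_m})
    (M : 'I_m -> 'I_m -> R) (z : 'I_k -> 'rV[R]_m) : Prop :=
  forall j j' c, c \notin J ->
    z j ord0 c - z j' ord0 c =
    \sum_(a in J) M c a * (z j ord0 a - z j' ord0 a).

(** The set [S] says which slopes may differ from 0; it encodes the two
    coordinate planes to which the plane is parallel, and its cardinal counts
    the free slopes.  The bound on the slopes makes the condition closed in [z]. *)
Definition aligned (R : realFieldType) (m : nat) (S : {set 'I_m * 'I_m})
    (J : {set 'I_m}) (k : nat) (z : 'I_k -> 'rV[R]_m) : Prop :=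
  exists M : 'I_m -> 'I_m -> R,
    [/\ forall c a, `|M c a| <= 1,
        forall c a, (c, a) \notin S -> M c a = 0
      & graph_over J M z].

Lemma normrB_mul_le (R : realFieldType) (x y x' y' X Y dx dy : R) :
  `|x'| <= X -> `|y| <= Y -> `|x - x'| <= dx -> `|y - y'| <= dy ->
  `|x * y - x' * y'| <= dx * Y + X * dy.
Proof.
move=> hX hY hx hy.
have -> : x * y - x' * y' = (x - x') * y + x' * (y - y') by ring.
apply: (le_trans (ler_normD _ _)); rewrite !normrM.
by apply: lerD; apply: ler_pM.
Qed.

Lemma norm_sum_le (R : realFieldType) (I : finType) (P : pred I) (F : I -> R)
    (N : nat) (b : R) :
  0 <= b -> (#|I| <= N)%N -> (forall i, P i -> `|F i| <= b) ->
  `|\sum_(i | P i) F i| <= N%:R * b.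
Proof.
move=> b0 IN hF; apply: (le_trans (ler_norm_sum _ _ _)).
apply: (le_trans (ler_sum _ hF)).
rewrite sumr_const mulr_natl -!(mulr_natl b); apply: ler_wpM2r => //.
by rewrite ler_nat (leq_trans _ IN) // max_card.
Qed.

(** In each simplex one vertex, [top j], is recovered from the point [z j], the
    other vertices and the ratios [nu j] of the barycentric coordinates to that
    of [top j].  These relations are polynomial with bounded data, hence
    Lipschitz: parameters that agree up to [delta] give vertices [top j] that
    agree up to a fixed multiple of [delta]. *)
Lemma vertex_stability (R : realFieldType) (m N k : nat) (J : {set 'I_m})
    (p p' : 'I_N -> 'rV[R]_m) (z z' : 'I_k.+1 -> 'rV[R]_m)
    (nu nu' : 'I_k.+1 -> 'I_N -> R) (M M' : 'I_m -> 'I_m -> R)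
    (top : 'I_k.+1 -> 'I_N) (B delta : R) :
  1 <= B -> 0 <= delta ->
  (forall i c, `|p i ord0 c| <= B) ->
  (forall j c, `|z j ord0 c| <= B) -> (forall j c, `|z' j ord0 c| <= B) ->
  (forall j i, `|nu j i| <= 1) -> (forall j i, `|nu' j i| <= 1) ->
  (forall c a, `|M c a| <= 1) -> (forall c a, `|M' c a| <= 1) ->
  graph_over J M z -> graph_over J M' z' ->
  (forall j c, p (top j) ord0 c =
     (\sum_i nu j i) * z j ord0 c -
     \sum_(i | i != top j) nu j i * p i ord0 c) ->
  (forall j c, p' (top j) ord0 c =
     (\sum_i nu' j i) * z' j ord0 c -
     \sum_(i | i != top j) nu' j i * p' i ord0 c) ->
  (forall j i, `|nu j i - nu' j i| <= delta) ->
  (forall c a, `|M c a - M' c a| <= delta) ->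
  (forall j a, a \in J -> `|z j ord0 a - z' j ord0 a| <= delta) ->
  (forall c, c \notin J -> `|z ord0 ord0 c - z' ord0 ord0 c| <= delta) ->
  (forall j i c, i != top j -> nu' j i != 0 -> p i ord0 c = p' i ord0 c) ->
  forall j c, `|p (top j) ord0 c - p' (top j) ord0 c| <=
    (N%:R * B + N%:R * (1 + m%:R * (2 * B + 2)) + N%:R * B) * delta.
Proof.
move=> B1 d0 pB zB z'B nu1 nu'1 M1 M'1 zM z'M pE p'E dnu dM dzJ dz0 pp' j c.
(* Off J, a coordinate of [z j] is that of the base point [z ord0] plus the
   slopes applied to the J-coordinates. *)
have dz c' : `|z j ord0 c' - z' j ord0 c'| <= (1 + m%:R * (2 * B + 2)) * delta.
  have m0 : 0 <= m%:R :> R by [].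
  have [c'J|c'J] := boolP (c' \in J).
    apply: (le_trans (dzJ j _ c'J)); rewrite mulrDl mul1r lerDl.
    by rewrite !mulr_ge0 //; lra.
  have e1 := zM j ord0 _ c'J; have e2 := z'M j ord0 _ c'J.
  have -> : z j ord0 c' - z' j ord0 c' = (z ord0 ord0 c' - z' ord0 ord0 c') +
      \sum_(a in J) (M c' a * (z j ord0 a - z ord0 ord0 a) -
                     M' c' a * (z' j ord0 a - z' ord0 ord0 a)).
    by rewrite sumrB -e1 -e2; ring.
  rewrite mulrDl mul1r; apply: (le_trans (ler_normD _ _)).
  apply: lerD; first exact: dz0.
  rewrite -mulrA; apply: norm_sum_le; first by rewrite mulr_ge0 //; lra.
    by rewrite card_ord.
  move=> a aJ.
  have -> : (2 * B + 2) * delta = delta * (2 * B) + 1 * (2 * delta) by ring.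
  apply: normrB_mul_le => //.
    by rewrite mulr2n mulrDl mul1r (le_trans (ler_normB _ _)) ?lerD.
  have -> : z j ord0 a - z ord0 ord0 a - (z' j ord0 a - z' ord0 ord0 a) =
    (z j ord0 a - z' j ord0 a) - (z ord0 ord0 a - z' ord0 ord0 a) by ring.
  by rewrite mulr2n mulrDl mul1r (le_trans (ler_normB _ _)) ?lerD ?dzJ.
rewrite pE p'E.
set Z := 1 + _ in dz *.
have Z0 : 0 <= Z by rewrite addr_ge0 // mulr_ge0 //; lra.
have -> : (\sum_i nu j i) * z j ord0 c - \sum_(i | i != top j) nu j i * p i ord0 c -
   ((\sum_i nu' j i) * z' j ord0 c - \sum_(i | i != top j) nu' j i * p' i ord0 c) =
   ((\sum_i nu j i) * z j ord0 c - (\sum_i nu' j i) * z' j ord0 c) -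
   \sum_(i | i != top j) ((nu j i - nu' j i) * p i ord0 c).
  have <- : \sum_(i | i != top j) nu j i * p i ord0 c -
       \sum_(i | i != top j) nu' j i * p' i ord0 c =
       \sum_(i | i != top j) ((nu j i - nu' j i) * p i ord0 c).
    rewrite -sumrB; apply: eq_bigr => i it.
    have [->|ne] := eqVneq (nu' j i) 0; first by ring.
    by rewrite (pp' j) //; ring.
  by ring.
apply: (le_trans (ler_normB _ _)); rewrite [X in _ <= X]mulrDl; apply: lerD.
  have -> : (N%:R * B + N%:R * Z) * delta =
            (N%:R * delta) * B + N%:R * (Z * delta) by ring.
  apply: normrB_mul_le => //.
    rewrite -[N%:R]mulr1; apply: norm_sum_le => //; by rewrite card_ord.
  rewrite -sumrB; apply: norm_sum_le => //; by rewrite card_ord.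
rewrite -mulrA; apply: norm_sum_le => [||i _].
- by rewrite mulr_ge0 //; lra.
- by rewrite card_ord.
- by rewrite normrM mulrC; apply: ler_pM.
Qed.

Lemma truncn_eq_dist (R : archiRealFieldType) (x y d : R) :
  0 < d -> 0 <= x -> 0 <= y -> Num.truncn (x / d) = Num.truncn (y / d) ->
  `|x - y| <= d.
Proof.
move=> d0 x0 y0 e.
have hx := @truncn_itv R (x / d) (divr_ge0 x0 (ltW d0)).
have hy := @truncn_itv R (y / d) (divr_ge0 y0 (ltW d0)).
rewrite e in hx; move: hx hy.
rewrite !ler_pdivlMr // !ltr_pdivrMr // -natr1 mulrDl mul1r.
move=> /andP[? ?] /andP[? ?]; rewrite ler_norml; apply/andP; split; lra.
Qed.

Lemma heaviest_vertex (R : realFieldType) (N : nat) (w : 'I_N -> R) :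
  (forall i, 0 <= w i) -> \sum_i w i = 1 ->
  exists2 i0, 0 < w i0 & forall i, w i <= w i0.
Proof.
move=> w0 w1.
have [i wi|no] := pickP (fun i => 0 < w i); last first.
  have : \sum_i w i = 0.
    by apply: big1 => i _; apply/eqP; rewrite eq_le w0 andbT leNgt no.
  by rewrite w1 => /eqP; rewrite oner_eq0.
have [i0 _ max_i0] := @arg_maxP _ R 'I_N i xpredT w isT.
by exists i0; [apply: lt_le_trans (max_i0 i isT)|move=> i'; apply: max_i0].
Qed.

Lemma natr_dist_lt1 (R : realFieldType) (a b : nat) :
  `|a%:R - b%:R| < 1 :> R -> a = b.
Proof.
rewrite ltr_distl => /andP[ab ba].
have {}ab : (b < a.+1)%N by rewrite -(ltr_nat R) -natr1; lra.
have {}ba : (a < b.+1)%N by rewrite -(ltr_nat R) -natr1; lra.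
by apply/eqP; rewrite eqn_leq; apply/andP; split.
Qed.

(** Barycentric coordinates of [k] points in pairwise disjoint faces, of
    dimension at most [n], of a simplex with [N] vertices. *)
Definition disjoint_carriers (R : realFieldType) (n N k : nat)
    (lam : 'I_k -> 'I_N -> R) : Prop :=
  [/\ forall j i, 0 <= lam j i,
      forall j, \sum_i lam j i = 1,
      forall j, (#|[set i | lam j i != 0%R]| <= n.+1)%N
    & forall i j j', lam j i != 0 -> lam j' i != 0 -> j = j'].

(** The contradiction hypothesis makes every grid position [p a] of the vertices
    bad.  In each simplex the vertex [t a j] of largest weight is distinguished,
    so that the weight ratios [nu] lie between 0 and 1.  The parameters of a bad
    position are the ratios ([k n] of them), the [J]-coordinates of the points,
    the other coordinates of the first point, and the slopes in [S]; the
    vertices that are not distinguished are kept exactly.  Two bad positions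
    with the same rounded parameters are equal by [vertex_stability]. *)
Lemma generic_vertices (R : archiRealFieldType) (m n N k : nat)
    (S : {set 'I_m * 'I_m}) (J : {set 'I_m}) (q : 'I_N -> 'rV[R]_m) (eta : R) :
  0 < eta ->
  (k * n + k * #|J| + (m - #|J|) + #|S| < k * m)%N ->
  exists p : 'I_N -> 'rV[R]_m,
    (forall i c, `|p i ord0 c - q i ord0 c| <= eta) /\
    forall lam : 'I_k -> 'I_N -> R, disjoint_carriers n lam ->
      ~ aligned S J (fun j => \sum_i lam j i *: p i).
Proof.
case: k => [|k]; first by rewrite !mul0n.
have quot (x y u v : R) : x / (y / (u * v)) = x * v / y * u.
  by rewrite invfM invrK; ring.
have cell_small (x y u : R) : 0 <= x -> 0 < y -> 0 < u ->
    x * (y / (u * (x + 1))) < y / u.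
  move=> x0 y0 u0; have x1 : 0 < x + 1 by lra.
  have -> : x * (y / (u * (x + 1))) = (y / u) * (x / (x + 1)).
    by field; rewrite !gt_eqF.
  by rewrite gtr_pMr ?divr_gt0 // ltr_pdivrMr //; lra.
have dim_count (u : nat) : (u < k.+1 * m -> k.+1 * m <= N * m ->
  N * m - k.+1 * m + u < N * m)%N by lia.
move=> eta0 count; apply: contrapT => nop.
have [B [B1 qB]] : exists B : R, 1 <= B /\ forall i c, eta + `|q i ord0 c| <= B.
  exists (1 + (eta + \sum_i \sum_c `|q i ord0 c|)); split=> [|i c].
    by rewrite lerDl addr_ge0 ?(ltW eta0) // sumr_ge0 // => i _; rewrite sumr_ge0.
  rewrite -[leLHS]add0r; apply: lerD => //; rewrite lerD2l.
  rewrite (bigD1 i) //= (bigD1 c) //= -addrA lerDl addr_ge0 ?sumr_ge0 // => i' _.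
  by rewrite sumr_ge0.
(* The Lipschitz constant of [vertex_stability]. *)
pose L : R := N%:R * B + N%:R * (1 + m%:R * (2 * B + 2)) + N%:R * B.
have L0 : 0 <= L.
  have B0 : 0 <= B by lra.
  have N0 := ler0n R N; have m0 := ler0n R m.
  have NB := mulr_ge0 N0 B0.
  have : 0 <= N%:R * (1 + m%:R * (2 * B + 2)).
    by rewrite mulr_ge0 // addr_ge0 // mulr_ge0 //; lra.
  by rewrite /L; lra.
pose I := ('I_k.+1 * 'I_n + 'I_k.+1 * {a | a \in J} +
           {c | c \in ~: J} + {x | x \in S})%type.
pose C := ({ffun 'I_k.+1 -> {set 'I_N}} * {ffun 'I_k.+1 -> 'I_N})%type.
have [K K_big] : exists K, 2 * B * (L + 1) / eta < K%:R.
  by exists (Num.truncn (2 * B * (L + 1) / eta)).+1; apply: truncnS_gt.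
have [r r_big] : exists r, (#|{: C}| * K ^ #|{: I}| < r)%N by eexists.
(* The precision delta is chosen so that L * delta is less than the mesh w. *)
pose delta := eta / (r%:R * (L + 1)).
have r0 : 0 < r%:R :> R by rewrite ltr0n (leq_ltn_trans _ r_big).
have d0 : 0 < delta by rewrite divr_gt0 // mulr_gt0 // ltr_wpDl.
pose w := eta / r%:R.
have w0 : 0 < w by rewrite divr_gt0.
pose grid := {ffun 'I_N * 'I_m -> 'I_r}.
pose p (a : grid) i : 'rV[R]_m :=
  \row_c (q i ord0 c + w * (a (i, c))%:R).
have pq a i c : `|p a i ord0 c - q i ord0 c| <= eta.
  rewrite mxE addrAC subrr add0r (ger0_norm (mulr_ge0 (ltW w0) (ler0n _ _))).
  have -> : eta = w * r%:R by rewrite /w divfK // gt_eqF.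
  by apply: ler_wpM2l; [exact: ltW|rewrite ler_nat ltnW].
pose z (a : grid) (lam : 'I_k.+1 -> 'I_N -> R) j := \sum_i lam j i *: p a i.
pose data := (('I_k.+1 -> 'I_N -> R) * ('I_m -> 'I_m -> R) *
              ('I_k.+1 -> 'I_N))%type.
have /choice[dat datP] : forall a : grid, exists lMt : data,
    let: (lam, M, t) := lMt in
    [/\ disjoint_carriers n lam,
        (forall c b, `|M c b| <= 1) /\
        (forall c b, (c, b) \notin S -> M c b = 0),
        graph_over J M (z a lam)
      & forall j, 0 < lam j (t j) /\ forall i, lam j i <= lam j (t j)].
  move=> a; apply: contrapT => nobad; apply: nop; exists (p a).
  split=> [i c|]; first exact: pq.
  move=> lam lamP [M [M1 M2 M3]]; apply: nobad.
  have /choice[t tP] : forall j, exists i0,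
      0 < lam j i0 /\ forall i, lam j i <= lam j i0.
    move=> j; case: lamP => l0 l1 _ _.
    by have [i0 ? ?] := heaviest_vertex (l0 j) (l1 j); exists i0.
  by exists (lam, M, t).
pose lam a := (dat a).1.1; pose M a := (dat a).1.2; pose t a := (dat a).2.
have {}datP a : [/\ disjoint_carriers n (lam a),
    (forall c b, `|M a c b| <= 1) /\
    (forall c b, (c, b) \notin S -> M a c b = 0),
    graph_over J (M a) (z a (lam a))
  & forall j, 0 < lam a j (t a j) /\ forall i, lam a j i <= lam a j (t a j)].
  by have := datP a; rewrite /lam /M /t; case: (dat a) => -[].
pose nu a j i := lam a j i / lam a j (t a j).
pose s a j := [set i | lam a j i != 0].
have t0 a j : 0 < lam a j (t a j) by have [_ _ _ /(_ j)[]] := datP a.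
have ts a j : t a j \in s a j by rewrite inE (gt_eqF (t0 _ _)).
have l0 a j i : 0 <= lam a j i by have [[h _ _ _] _ _ _] := datP a; exact: h.
have l1 a j : \sum_i lam a j i = 1 by have [[_ h _ _] _ _ _] := datP a; exact: h.
have nu01 a j i : 0 <= nu a j i <= 1.
  rewrite (divr_ge0 (l0 _ _ _) (ltW (t0 _ _))) (ler_pdivrMr _ _ (t0 _ _)) mul1r.
  by have [_ _ _ /(_ j)[_ ->]] := datP a.
have nu_out a j i : i \notin s a j -> nu a j i = 0.
  by rewrite inE negbK => /eqP e; rewrite /nu (_ : lam a j i = 0) ?mul0r.
have t_inj a : injective (t a).
  move=> j j' e; have [[_ _ _ dj] _ _ _] := datP a.
  by apply: (dj (t a j)); rewrite ?(gt_eqF (t0 a j)) // e (gt_eqF (t0 a j')).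
have pB a i c : `|p a i ord0 c| <= B.
  rewrite -[X in `|X|](subrK (q i ord0 c)).
  apply: (le_trans (ler_normD _ _)).
  exact: le_trans (lerD (pq a i c) (lexx _)) (qB i c).
have zE a j c : z a (lam a) j ord0 c = \sum_i lam a j i * p a i ord0 c.
  by rewrite summxE; apply: eq_bigr => i _; rewrite mxE.
have zB a j c : `|z a (lam a) j ord0 c| <= B.
  rewrite zE; apply: (le_trans (ler_norm_sum _ _ _)).
  rewrite -[B]mul1r -(l1 a j) mulr_suml; apply: ler_sum => i _.
  by rewrite normrM ger0_norm // ler_wpM2l.
have topE a j c : p a (t a j) ord0 c =
    (\sum_i nu a j i) * z a (lam a) j ord0 c -
    \sum_(i | i != t a j) nu a j i * p a i ord0 c.
  have -> : \sum_i nu a j i = (lam a j (t a j))^-1 by rewrite -mulr_suml l1 mul1r.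
  have -> : (lam a j (t a j))^-1 * z a (lam a) j ord0 c =
            \sum_i nu a j i * p a i ord0 c.
    by rewrite zE mulr_sumr; apply: eq_bigr => i _; rewrite /nu; ring.
  rewrite (bigD1 (t a j)) //= /nu divff ?mul1r ?addrK //.
  by rewrite gt_eqF.
(* There are at most n ratios per simplex besides that of [t a j], which is 1;
   they are listed in the order of the enumeration of the support, and the
   default value [t a j] of [nth] fills the unused slots. *)
pose par a (x : I) : R := match x with
  | inl (inl (inl (j, l))) => nu a j (nth (t a j) (enum (s a j :\ t a j)) l)
  | inl (inl (inr (j, u))) => z a (lam a) j ord0 (val u)
  | inl (inr c) => z a (lam a) ord0 ord0 (val c)
  | inr x => M a (val x).1 (val x).2 end.
have parB a x : `|par a x| <= B.
  case: x => [[[[j l]|[j u]]|c]|x] /=; rewrite ?zB //.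
    case/andP: (nu01 a j (nth (t a j) (enum (s a j :\ t a j)) l)) => h1 h2.
    by rewrite ger0_norm // (le_trans h2).
  by have [_ [h _] _ _] := datP a; apply: le_trans B1; apply: h.
have par0 a x : 0 <= par a x + B.
  by have := parB a x; rewrite ler_norml -subr_ge0 opprK => /andP[].
have cell_lt a x : (Num.truncn ((par a x + B) / delta) < K * r)%N.
  rewrite (truncn_lt_nat _ (divr_ge0 (par0 a x) (ltW d0))).
  have h : par a x + B <= 2 * B.
    by rewrite mulr2n mulrDl mul1r lerD2r (le_trans (ler_norm _) (parB a x)).
  apply: (@le_lt_trans _ _ (2 * B / delta)); first by rewrite ler_pM2r // invr_gt0.
  have -> : 2 * B / delta = 2 * B * (L + 1) / eta * r%:R.
    by rewrite /delta; apply: quot.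
  by rewrite natrM ltr_pM2r.
pose cell a := [ffun x => Ordinal (cell_lt a x)].
pose chart a : C := ([ffun j => s a j], [ffun j => t a j]).
pose fixed (c : C) : {set 'I_N * 'I_m} :=
  finset.setX (~: [set c.2 j | j : 'I_k.+1]) [set: 'I_m].
have few a : (#|fixed (chart a)| + #|{: I}| < #|{: 'I_N * 'I_m}|)%N.
  rewrite cardsX cardsT card_prod !card_ord.
  have -> : #|{: I}| = (k.+1 * n + k.+1 * #|J| + (m - #|J|) + #|S|)%N.
    rewrite !card_sum !card_prod !card_sig !card_ord.
    have cJ : #|~: J| = (m - #|J|)%N by rewrite cardsCs finset.setCK card_ord.
    by rewrite -cJ; congr (_ + _ * _ + _ + _)%N; apply: eq_card => x; rewrite inE.
  have im_card : #|[set (chart a).2 j | j : 'I_k.+1]| = k.+1.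
    rewrite card_imset ?card_ord // => j j'; rewrite !ffunE; exact: t_inj.
  have := max_card (mem [set (chart a).2 j | j : 'I_k.+1]).
  rewrite im_card card_ord => kN.
  rewrite cardsCs finset.setCK im_card card_ord mulnBl.
  by apply: dim_count => //; rewrite leq_mul2r kN orbT.
have [a [a' [ne ec el fx]]] := @grid_collision _ _ _ r K chart fixed cell few r_big.
have [es et] : s a = s a' /\ t a = t a'.
  case: ec => /ffunP h1 /ffunP h2; split; apply/funext => j.
    by have := h1 j; rewrite !ffunE.
  by have := h2 j; rewrite !ffunE.
have dpar x : `|par a x - par a' x| <= delta.
  have /ffunP/(_ x) := el; rewrite !ffunE => /(congr1 val) /=.
  move/(truncn_eq_dist d0 (par0 _ _) (par0 _ _)).
  by have -> : par a x + B - (par a' x + B) = par a x - par a' x by ring.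
have same i c : i \notin [set t a j | j : 'I_k.+1] -> a (i, c) = a' (i, c).
  move=> it; apply: fx; rewrite inE /= finset.in_setT andbT inE.
  apply: contra it => /imsetP[j _ ->]; apply/imsetP; exists j => //.
  by rewrite ffunE.
have close j c : `|p a (t a j) ord0 c - p a' (t a j) ord0 c| <= L * delta.
  have [[_ _ ca _] [Ma1 Ma0] zMa _] := datP a.
  have [[_ _ _ dja'] [Ma'1 Ma'0] zMa' _] := datP a'.
  have nu1 b j' i : `|nu b j' i| <= 1.
    by have /andP[? ?] := nu01 b j' i; rewrite ger0_norm.
  apply: (@vertex_stability R m N k J (p a) (p a') (z a (lam a)) (z a' (lam a'))
            (nu a) (nu a') (M a) (M a') (t a)) => //.
  - exact: ltW.
  - by move=> j' c'; rewrite et; apply: topE.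
  - move=> j' i.
    have [->|nti] := eqVneq i (t a j').
      rewrite /nu -et !divff ?subrr ?normr0 ?(ltW d0) //; last by rewrite gt_eqF.
      by rewrite et gt_eqF.
    have [isj|nis] := boolP (i \in s a j'); last first.
      have nis' : i \notin s a' j' by rewrite -es.
      by rewrite !nu_out // subrr normr0 ltW.
    have i_in : i \in s a j' :\ t a j' by rewrite finset.in_setD1 nti.
    have li : (index i (enum (s a j' :\ t a j')) < n)%N.
      rewrite -ltnS; apply: leq_trans (ca j').
      rewrite [leqRHS](cardsD1 (t a j')) ts add1n ltnS cardE index_mem mem_enum.
      exact: i_in.
    have := dpar (inl (inl (inl (j', Ordinal li)))) => /=.
    by rewrite -es -et nth_index // mem_enum.
  - move=> c' b; have [cbS|ncb] := boolP ((c', b) \in S).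
      exact: (dpar (inr (exist _ (c', b) cbS))).
    by rewrite Ma0 // Ma'0 // subrr normr0 ltW.
  - by move=> j' b bJ; exact: (dpar (inl (inl (inr (j', exist _ b bJ))))).
  - move=> c' c'J; have c'J' : c' \in ~: J by rewrite inE.
    exact: (dpar (inl (inr (exist _ c' c'J')))).
  - move=> j' i c' it nui; rewrite !mxE same //.
    apply/imsetP => -[j'' _ ij'']; case/eqP: it; rewrite ij''; congr (t a _).
    apply: (dja' i); last first.
      by apply: contra nui => /eqP e; rewrite /nu (_ : lam a' j' i = 0) ?mul0r.
    by rewrite ij'' et; have := ts a' j''; rewrite inE.
case/eqP: ne; apply/ffunP => -[i c].
have [/imsetP[j _ ij]|] := boolP (i \in [set t a j | j : 'I_k.+1]); last first.
  exact: same.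
have := close j c; rewrite -ij !mxE.
have -> : q i ord0 c + w * (a (i, c))%:R - (q i ord0 c + w * (a' (i, c))%:R) =
  w * ((a (i, c))%:R - (a' (i, c))%:R) by ring.
rewrite normrM gtr0_norm //.
move/le_lt_trans/(_ (cell_small _ _ _ L0 eta0 r0)).
by rewrite gtr_pMr // => /natr_dist_lt1 e; apply/val_inj.
Qed.

(** * Subspaces between coordinate planes as bounded graphs *)

Lemma det_replace_col (R : comNzRingType) (d : nat) (N : 'M[R]_d) (i : 'I_d) :
  (forall a b, b != i -> N a b = (a == b)%:R) -> \det N = N i i.
Proof.
move=> NE; rewrite (expand_det_col _ i).
have cofE a : cofactor N a i = cofactor 1%:M a i.
  rewrite /cofactor; congr (_ * \det _); apply/matrixP => x y; rewrite !mxE.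
  by rewrite NE // eq_sym neq_lift.
have adj1 : \adj (1%:M : 'M[R]_d) = 1%:M by rewrite -[LHS]mul1mx mul_mx_adj det1.
have cof1 a : cofactor 1%:M a i = (i == a)%:R :> R.
  by have /matrixP/(_ i a) := adj1; rewrite !mxE.
rewrite (bigD1 i) //= cofE cof1 eqxx mulr1 big1 ?addr0 // => a ai.
by rewrite cofE cof1 eq_sym (negbTE ai) mulr0.
Qed.

(** Among all choices of [d] columns of [B], take one whose minor has the
    largest absolute value.  By Cramer's rule the coefficients that express a
    column in the chosen ones are quotients of minors by this one. *)
Lemma bounded_chart (R : realFieldType) (d m : nat) (B : 'M[R]_(d, m)) :
  row_free B -> exists (f : 'I_d -> 'I_m) (M : 'M[R]_(d, m)),
    [/\ forall i c, `|M i c| <= 1,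
        forall i i', M i (f i') = (i == i')%:R,
        forall i, exists u : 'rV[R]_d, row i M = u *m B
      & forall (u : 'rV[R]_d) c,
          (u *m B) ord0 c = \sum_i M i c * (u *m B) ord0 (f i)].
Proof.
move=> Bfree.
have BTfull : row_full B^T by rewrite /row_full mxrank_tr.
pose f0 : {ffun 'I_d -> 'I_m} := [ffun i => fullrankfun BTfull i].
have f0_unit : \det (colsub f0 B) != 0.
  rewrite -unitfE -[_ \is a _]/(_ \in unitmx) -unitmx_tr.
  have -> : (colsub f0 B)^T = rowsub (fullrankfun BTfull) B^T.
    by apply/matrixP => i j; rewrite !mxE ffunE.
  exact: fullrowsub_unit.
pose minor (f : {ffun 'I_d -> 'I_m}) := `|\det (colsub f B)|.
have [f _ fmax] := @arg_maxP _ R {ffun 'I_d -> 'I_m} f0 xpredT minor isT.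
have det_gt0 : 0 < `|\det (colsub f B)|.
  by apply: lt_le_trans (fmax f0 isT); rewrite /minor normr_gt0.
have f_unit : colsub f B \in unitmx by rewrite unitmxE unitfE -normr_gt0.
pose M := invmx (colsub f B) *m B.
have BM : colsub f B *m M = B by rewrite /M mulKVmx.
have Mf : colsub f M = 1%:M by rewrite -mulmx_colsub mulVmx.
have MfE i i' : M i (f i') = (i == i')%:R.
  by have /matrixP/(_ i i') := Mf; rewrite !mxE.
exists f, M; split=> // [i c|i|u c]; last 2 first.
- by exists (row i (invmx (colsub f B))); rewrite -row_mul.
- have {1}-> : u *m B = colsub f (u *m B) *m M by rewrite -mulmx_colsub -mulmxA BM.
  by rewrite mxE; apply: eq_bigr => i _; rewrite !mxE mulrC.
- pose g : {ffun 'I_d -> 'I_m} := [ffun i' => if i' == i then c else f i'].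
  have := fmax g isT; rewrite /minor.
  have -> : colsub g B = colsub f B *m colsub g M by rewrite mulmx_colsub BM.
  have -> : \det (colsub f B *m colsub g M) = \det (colsub f B) * M i c.
    rewrite det_mulmx (@det_replace_col _ _ (colsub g M) i).
      by rewrite mxE ffunE eqxx.
    by move=> a b bi; rewrite mxE ffunE (negbTE bi) MfE.
  by rewrite normrM /= ger_pMr.
Qed.

Section coordinate_planes.
Variables (R : realFieldType) (m : nat).
Implicit Types (A : {set 'I_m}) (V : {vspace 'rV[R]_m}).

Definition coordinate_span A : {vspace 'rV[R]_m} :=
  <<[seq (delta_mx ord0 i : 'rV[R]_m) | i <- enum A]>>%VS.

Lemma coordinate_spanP A (v : 'rV[R]_m) :
  reflect (forall c, c \notin A -> v ord0 c = 0) (v \in coordinate_span A).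
Proof.
apply: (iffP idP) => [vA c cA|v0].
  move: vA; rewrite -[X in X \in _]/(v) => vA.
  have -> := coord_span (X := in_tuple _) vA.
  rewrite summxE big1 // => i _; rewrite mxE.
  have := mem_nth 0 (ltn_ord i : (i < size (in_tuple _))%N) => /=.
  case/mapP => a; rewrite mem_enum => aA ->.
  rewrite mxE /= (negbTE (_ : c != a)) ?mulr0 //.
  by apply: contraNneq cA => ->.
rewrite [v]row_sum_delta; apply: memv_suml => c _.
have [cA|cA] := boolP (c \in A); last by rewrite v0 // scale0r mem0v.
by apply/memvZ/memv_span/map_f; rewrite mem_enum.
Qed.

Lemma dim_coordinate_span A : \dim (coordinate_span A) = #|A|.
Proof.
rewrite /coordinate_span.
set X := map _ _; have : free (in_tuple X).
  apply/freeP => k sum0 i.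
  have sX (j : 'I_(size X)) : (j < size (enum A))%N.
    by rewrite -(size_map (fun i => delta_mx ord0 i : 'rV[R]_m)) ltn_ord.
  have [a0 _] : exists a0 : 'I_m, true.
    by move: (sX i); case: (enum A) => // a ? _; exists a.
  have XE (j : 'I_(size X)) : (in_tuple X)`_j = delta_mx ord0 (nth a0 (enum A) j).
    by rewrite /= (nth_map a0).
  have /rowP/(_ (nth a0 (enum A) i)) := sum0.
  rewrite summxE mxE (bigD1 i) //= big1 ?addr0 => [|j ji].
    by rewrite mxE (XE i) mxE !eqxx mulr1.
  rewrite mxE (XE j) mxE eqxx /= nth_uniq ?enum_uniq //.
  by rewrite eq_sym (negbTE ji : (j == i :> nat) = false) mulr0.
by rewrite /free => /eqP ->; rewrite size_map -cardE.
Qed.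

Lemma coordinate_span_sub A A' :
  (coordinate_span A <= coordinate_span A')%VS -> A \subset A'.
Proof.
move=> /subvP sub; apply/fintype.subsetP => a aA.
have : (delta_mx ord0 a : 'rV[R]_m) \in coordinate_span A.
  by apply/memv_span/map_f; rewrite mem_enum.
move/sub/coordinate_spanP/(_ a) => h; apply/negPn/negP => /h.
by rewrite mxE !eqxx => /eqP; rewrite oner_eq0.
Qed.

(** The directions of [At] are split off from [V], and [bounded_chart] is applied
    to the complement [V'] of vectors of [V] that vanish on [At].  The chosen
    columns then lie in [AT] and off [At], and the rows of the chart belong to
    [V'], so its entries vanish where all vectors of [V'] do. *)
Lemma parallel_chart (At AT : {set 'I_m}) V :
  (coordinate_span At <= V)%VS -> (V <= coordinate_span AT)%VS ->
  exists J : {set 'I_m}, [/\ At \subset J, J \subset AT, #|J| = \dim V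
    & exists M : 'I_m -> 'I_m -> R,
      [/\ forall c a, `|M c a| <= 1,
        forall c a, (c, a) \notin finset.setX (AT :\: J) (J :\: At) -> M c a = 0
      & forall v c, v \in V -> c \notin J ->
          v ord0 c = \sum_(a in J) M c a * v ord0 a]].
Proof.
move=> AtV VAT; pose V' := (V :&: coordinate_span (~: At))%VS.
have V'P v : reflect (v \in V /\ forall c, c \in At -> v ord0 c = 0) (v \in V').
  rewrite memv_cap; apply: (iffP andP) => -[vV h]; split=> //.
    by move=> c cA; apply: (coordinate_spanP _ _ h); rewrite inE cA.
  by apply/coordinate_spanP => c; rewrite inE negbK; apply: h.
pose proj (v : 'rV[R]_m) : 'rV[R]_m := \row_c (if c \in At then v ord0 c else 0).
have proj_in v : proj v \in coordinate_span At.
  by apply/coordinate_spanP => c cA; rewrite mxE (negbTE cA).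
have rest_in v : v \in V -> v - proj v \in V'.
  move=> vV; apply/V'P; split=> [|c cA].
    by rewrite memvB // (subvP AtV) // proj_in.
  by rewrite !mxE cA subrr.
have dimV : \dim V = (#|At| + \dim V')%N.
  rewrite -dim_coordinate_span -dimv_disjoint_sum.
    congr (\dim _); apply: subv_anti; apply/andP; split.
      apply/subvP => v vV; rewrite -[v](subrK (proj v)) addrC.
      by rewrite memv_add // rest_in.
    by rewrite subv_add AtV capvSl.
  apply/eqP; rewrite -subv0; apply/subvP => v.
  rewrite memv_cap => /andP[vA /V'P[_ v0]].
  rewrite memv0; apply/eqP/rowP => c; rewrite mxE.
  have [cA|cA] := boolP (c \in At); first exact: v0.
  exact: (coordinate_spanP _ _ vA).
pose B : 'M[R]_(\dim V', m) := \matrix_i (vbasis V')`_i.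
have mulB (u : 'rV_(\dim V')) : u *m B = \sum_i u ord0 i *: (vbasis V')`_i.
  by rewrite mulmx_sum_row; apply: eq_bigr => i _; rewrite rowK.
have Bfree : row_free B.
  apply: inj_row_free => u; rewrite mulB => u0; apply/rowP => i; rewrite mxE.
  by have /freeP := basis_free (vbasisP V'); apply.
have [f [M [M1 Mf MV' ME]]] := bounded_chart Bfree.
have inV' v : v \in V' -> v = (\row_i coord (vbasis V') i v) *m B.
  move=> vV'; rewrite mulB {1}(coord_vbasis vV').
  by apply: eq_bigr => i _; rewrite mxE.
have {}ME v c : v \in V' -> v ord0 c = \sum_i M i c * v ord0 (f i).
  by move=> vV'; rewrite (inV' _ vV') ME.
have Brow i : row i B \in V' by rewrite rowK vbasis_mem ?mem_nth ?size_tuple.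
have f_inj : injective f.
  move=> i i' e; apply/eqP; have := Mf i i; rewrite e Mf eqxx.
  by case: eqP => // _ /eqP; rewrite eq_sym oner_eq0.
have {}MV' i : row i M \in V'.
  have [u ->] := MV' i; rewrite mulB; apply: memv_suml => k _.
  by apply/memvZ/vbasis_mem; rewrite mem_nth ?size_tuple.
have f_out i : f i \notin At.
  apply/negP => fA; have /V'P[_ /(_ _ fA)] := MV' i.
  by rewrite mxE Mf eqxx => /eqP; rewrite oner_eq0.
have f_in i : f i \in AT.
  apply/negPn/negP => fA.
  have /V'P[/(subvP VAT)/coordinate_spanP/(_ _ fA)] := MV' i.
  by rewrite mxE Mf eqxx => /eqP; rewrite oner_eq0.
exists (At :|: [set f i | i : 'I_(\dim V')]); split.
- exact: finset.subsetUl.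
- rewrite finset.subUset (coordinate_span_sub (subv_trans AtV VAT)).
  by apply/fintype.subsetP => _ /imsetP[i _ ->].
- rewrite cardsU card_imset // card_ord dimV.
  rewrite (_ : _ :&: _ = finset.set0) ?cards0 ?subn0 //.
  apply/finset.setP => a; rewrite !inE.
  apply/negbTE/negP => /andP[aA /imsetP[i _ ai]].
  by move: (f_out i); rewrite -ai aA.
set J := _ :|: _; set S := finset.setX _ _.
exists (fun c a => if (c, a) \in S then \sum_(i | f i == a) M i c else 0); split.
- move=> c a; case: ifP => _; last by rewrite normr0.
  have [i /eqP fi|none] := pickP (fun i => f i == a); last first.
    by rewrite big_pred0 // normr0.
  rewrite (big_pred1 i) // => i'; rewrite /= -fi; exact: inj_eq.
- by move=> c a /negbTE ->.
move=> v c vV cJ.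
have [cAT|cAT] := boolP (c \in AT); last first.
  rewrite (coordinate_spanP _ _ (subvP VAT _ vV)) // big1 // => a _.
  by rewrite !inE (negbTE cAT) andbF mul0r.
have cAt : c \notin At by apply: contra cJ; rewrite inE => ->.
have -> : v ord0 c = (v - proj v) ord0 c by rewrite !mxE (negbTE cAt) subr0.
rewrite ME ?rest_in //.
transitivity (\sum_(a in J) \sum_(i | f i == a) M i c * v ord0 (f i)).
  rewrite (exchange_big_dep xpredT) //=; apply: eq_bigr => i _.
  rewrite (big_pred1 (f i)) => [|a].
    by rewrite !mxE (negbTE (f_out i)) subr0.
  rewrite /= eq_sym; case: eqP => [->|]; rewrite ?andbF ?andbT //.
  by rewrite inE imset_f ?orbT.
apply: eq_bigr => a aJ; rewrite /S finset.in_setX !finset.in_setD cJ cAT aJ andbT /=.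
have [aAt|aAt] /= := boolP (a \in At).
  by rewrite mul0r big1 // => i /eqP fi; move: (f_out i); rewrite fi aAt.
by rewrite mulr_suml; apply: eq_bigr => i /eqP ->.
Qed.
End coordinate_planes.

Local Open Scope classical_set_scope.
Local Open Scope card_scope.
Local Open Scope ring_scope.
Local Notation edist := Defs.edist.

(** * Metrizable spaces and compactness *)

(** Distances are transported to the given space, so that its homeomorphism with
    a metric space need not be carried along. *)
Definition compatible_metric (R : realType) (X : topologicalType)
    (d : X -> X -> R) : Prop :=
  [/\ forall x y, 0 <= d x y, forall x y, d x y = 0 <-> x = y,
      forall x y, d x y = d y x, forall x y z, d x z <= d x y + d y z
    & forall (x : X) (A : set X),
        nbhs x A <-> exists2 e, 0 < e & forall y, d x y < e -> A y].

Lemma metrizable_metric (R : realType) (X : topologicalType) :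
  metrizable R X -> exists d : X -> X -> R, compatible_metric d.
Proof.
move=> [M [h [k [hk kh hc kc]]]]; exists (fun x y => mdist (h x) (h y)); split.
- by move=> x y; exact: mdist_ge0.
- move=> x y; split=> [/mdist_positivity/(can_inj hk)//|->]; exact: mdistxx.
- by move=> x y; exact: metric_sym.
- by move=> x y z; exact: metric_triangle.
move=> x A; split.
- move=> nA; have : nbhs (h x) (k @^-1` A) by apply: kc; rewrite hk.
  move/nbhs_ballP => [e /= e0 sub]; exists e => // y xy.
  have : ball (h x) e (h y) by rewrite ballEmdist.
  by move/sub => /=; rewrite hk.
- move=> [e e0 sub].
  have : nbhs x (h @^-1` ball (h x) e) by apply: hc; exact: nbhsx_ballx.
  by apply: filterS => y /=; rewrite ballEmdist /= => /sub.
Qed.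

Section metric_facts.
Variables (R : realType) (X : topologicalType) (d : X -> X -> R).
Hypothesis dX : compatible_metric d.

Lemma cmetric_ge0 x y : 0 <= d x y. Proof. by have [h _ _ _ _] := dX. Qed.
Lemma cmetric_xx x : d x x = 0. Proof. by have [_ h _ _ _] := dX; apply/h. Qed.
Lemma cmetric_sym x y : d x y = d y x. Proof. by have [_ _ h _ _] := dX. Qed.
Lemma cmetric_triangle y x z : d x z <= d x y + d y z.
Proof. by have [_ _ _ h _] := dX. Qed.
Lemma nbhs_cmetric (x : X) (A : set X) :
  nbhs x A <-> exists2 e, 0 < e & forall y, d x y < e -> A y.
Proof. by have [_ _ _ _ h] := dX. Qed.
Lemma cmetric_gt0 x y : x <> y -> 0 < d x y.
Proof.
move=> xy; rewrite lt_neqAle cmetric_ge0 andbT eq_sym; apply/eqP => d0.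
by apply: xy; have [_ h _ _ _] := dX; apply/h.
Qed.

Lemma nbhs_cball x e : 0 < e -> nbhs x [set y | d x y < e].
Proof. by move=> e0; apply/nbhs_cmetric; exists e. Qed.

(** If [Q x r] means that a property holds in the ball of radius [r] about [x],
    then the supremum of the admissible radii in the unit interval is a
    1-Lipschitz function of [x].
    This yields continuous positive functions from radii that are only known to
    exist point by point. *)
Lemma lipschitz_envelope (Q : X -> R -> Prop) :
  (forall x, Q x 0) ->
  (forall x y r, Q x r -> d x y <= r -> Q y (r - d x y)) ->
  exists beta : X -> R,
    [/\ continuous beta, forall x r, 0 <= r <= 1 -> Q x r -> r <= beta x
      & forall x r, r < beta x -> exists r', [/\ r < r', r' <= 1 & Q x r']].
Proof.
move=> Q0 Qshift.
pose E x := [set r | 0 <= r <= 1 /\ Q x r].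
have Esup x : has_sup (E x).
  split; first by exists 0; split=> //; rewrite lexx ler01.
  by exists 1 => r [/andP[]].
have le_sup x r : 0 <= r <= 1 -> Q x r -> r <= sup (E x).
  by move=> r01 Qr; apply: ub_le_sup; [case: (Esup x)|split].
have sup_ge0 x : 0 <= sup (E x) by apply: le_sup => //; rewrite lexx ler01.
have lip x y : sup (E x) - d x y <= sup (E y).
  rewrite lerBlDr; apply: ge_sup; first by case: (Esup x).
  move=> r [/andP[r0 r1] Qr].
  have [dr|rd] := leP (d x y) r; last first.
    by apply: (le_trans (ltW rd)); rewrite lerDr.
  rewrite -lerBlDr; apply: le_sup; last exact: Qshift.
  by rewrite subr_ge0 dr lerBlDr (le_trans r1) // lerDl cmetric_ge0.
exists (fun x => sup (E x)); split=> //.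
- move=> x; apply/cvgrPdist_lt => e e0; near=> y.
  have xy : d x y < e by near: y; apply: nbhs_cball.
  have h1 := lip x y; have h2 := lip y x; rewrite cmetric_sym in h2.
  by rewrite ltr_norml; apply/andP; split; lra.
- by move=> x r /(sup_gt (Esup x).1)[r' [/andP[_ r'1] Qr'] rr']; exists r'.
Unshelve. all: by end_near. Qed.

(** The truncated distance to the complement of [O]. *)
Lemma open_bump (O : set X) : open O ->
  exists psi : X -> R, [/\ continuous psi, forall x, 0 <= psi x
    & forall x, 0 < psi x <-> O x].
Proof.
move=> oO.
have [|x y r Or xyr|psi [cpsi psi_ge psi_lt]] :=
    @lipschitz_envelope (fun x r => forall y, d x y < r -> O y).
- by move=> x y; rewrite ltNge cmetric_ge0.
- move=> z yz; apply: Or; apply: le_lt_trans (cmetric_triangle y _ _) _; lra.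
exists psi; split=> // x.
  by apply: psi_ge; [rewrite lexx ler01|move=> y; rewrite ltNge cmetric_ge0].
split=> [/psi_lt[r [r0 _ Or]]|Ox]; first by apply: Or; rewrite cmetric_xx.
have /nbhs_cmetric[e e0 Oe] : nbhs x O by exact: open_nbhs_nbhs.
apply: (@lt_le_trans _ _ (Num.min e 1)); first by rewrite lt_min e0 ltr01.
apply: psi_ge; first by rewrite le_min (ltW e0) ler01 ge_min lexx orbT.
by move=> y; rewrite lt_min => /andP[/Oe].
Qed.
End metric_facts.

Section compactness.
Variables (X Y : topologicalType).

(** The near-covering property, for the filter of finite sequences of points of
    [K] directed by inclusion. *)
Lemma compact_finite_cover (K : set X) (O : X -> set X) :
  compact K -> (forall x, K x -> nbhs x (O x)) ->
  exists s : seq X, (forall x, x \in s -> K x) /\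
    forall x, K x -> exists2 y, y \in s & O y x.
Proof.
move=> /compact_near_coveringP Kcover Onbhs.
pose F : set_system (seq X) :=
  filter_from [set s : seq X | forall x, x \in s -> K x]
    (fun s : seq X => [set s' : seq X |
       {subset s <= s'} /\ forall x, x \in s' -> K x]).
have FF : Filter F.
  apply: filter_from_filter; first by exists [::].
  move=> s s' sK s'K; exists (s ++ s').
    by move=> x /=; rewrite mem_cat => /orP[/sK|/s'K].
  by move=> t [sub tK]; split; split=> // x xs; apply: sub;
    rewrite mem_cat xs ?orbT.
have [x Kx|s sK sub] :=
    Kcover _ F (fun (s : seq X) x => exists2 y, y \in s & O y x) FF.
  exists (O x, [set s : seq X | x \in s]) => /=.
    split; first exact: Onbhs.
    exists [:: x]; first by move=> y; rewrite /= inE => /eqP ->.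
    by move=> s [xs _]; apply: xs; rewrite inE.
  by move=> [x' s] [/= Oxx' xs]; exists x.
by exists s; split=> // x Kx; apply: (sub s) => //; split.
Qed.

(** An ultrafilter need only enter every open neighbourhood of [K], and not [K]
    itself, to have a limit in [K]: otherwise it avoids a neighbourhood of each
    point of [K], hence the union of finitely many of them that cover [K]. *)
Lemma compact_ultra_limit (K : set X) (T : Type) (G : set_system T)
    (u : T -> X) : compact K -> UltraFilter G ->
  (forall O : set X, open O -> K `<=` O -> G (u @^-1` O)) ->
  exists2 x, K x & u @ G --> x.
Proof.
move=> Kc GU Gnear; apply: contrapT => nolim.
have /choice[W WP] : forall x, exists O : set X,
    K x -> open_nbhs x O /\ G (u @^-1` (~` O)).
  move=> x; have [Kx|nKx] := pselect (K x); last by exists setT.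
  apply: contrapT => noO; apply: nolim; exists x => // A.
  rewrite nbhsE => -[V [oV Vx] VA].
  have [|GnO] := in_ultra_setVsetC (u @^-1` V) GU.
    by apply: filterS => t /VA.
  by exfalso; apply: noO; exists V.
have [s [sK cov]] :=
  @compact_finite_cover K W Kc (fun x Kx => open_nbhs_nbhs (WP x Kx).1).
have GO : G (u @^-1` (\bigcup_(x in [set` s]) W x)).
  apply: Gnear; last by move=> x /cov[y ys Wyx]; exists y.
  by apply: bigcup_open => x /= /sK/WP[[]].
have GnO : G (u @^-1` (~` \bigcup_(x in [set` s]) W x)).
  elim: (s) sK => [|x s' IH] sK.
    by apply: filterS filterT => t _ [].
  have h1 := (WP x (sK x (mem_head _ _))).2.
  have h2 := IH (fun y ys => sK y (@mem_behead _ (x :: s') y ys)).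
  apply: filterS (filterI h1 h2) => t [/= nx ns] [y].
  rewrite /= inE => /orP[/eqP-> //|ys Wy].
  by apply: ns; exists y.
by have [t [Ot nOt]] := filter_ex (filterI GO GnO).
Qed.

Lemma closed_map_tube (f : X -> Y) (y : Y) (O : set X) :
  (forall C : set X, closed C -> closed (f @` C)) -> open O ->
  f @^-1` [set y] `<=` O -> nbhs y [set y' | f @^-1` [set y'] `<=` O].
Proof.
move=> fcl oO sub.
have : open (~` (f @` (~` O))) by apply/closed_openC/fcl/open_closedC.
rewrite openE => /(_ y); rewrite /interior => h.
apply: filterS (h _) => [y' nf x fx|[x nOx fxy]].
  by apply: contrapT => nOx; apply: nf; exists x.
by apply: nOx; apply: sub.
Qed.
End compactness.

Section euclidean_distance.
Variables (R : realType) (m : nat).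
Implicit Types u v : 'rV[R]_m.

Lemma coord_le_edist u v c : `|u ord0 c - v ord0 c| <= edist u v.
Proof.
rewrite -sqrtr_sqr; apply: ler_wsqrtr.
by rewrite (bigD1 c) //= lerDl sumr_ge0 // => i _; rewrite sqr_ge0.
Qed.

Lemma edist_le_coord u v (b : R) : 0 <= b ->
  (forall c, `|u ord0 c - v ord0 c| <= b) -> edist u v <= m%:R * b.
Proof.
move=> b0 uv; rewrite -[leRHS]ger0_norm ?mulr_ge0 // -sqrtr_sqr.
apply: ler_wsqrtr; apply: (@le_trans _ _ (\sum_(i < m) b ^+ 2)).
  apply: ler_sum => i _.
  by rewrite -[X in X <= _]real_normK ?num_real // lerXn2r ?nnegrE.
rewrite sumr_const card_ord -[leLHS]mulr_natl exprMn.
apply: ler_wpM2r; first exact: sqr_ge0.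
by rewrite -natrX ler_nat; case: (m) => // k; rewrite leq_pmulr.
Qed.
End euclidean_distance.

(** * The Baire property of the source limitation topology *)

Section row_norm.
Variables (R : realType) (m : nat).
Implicit Types u v : 'rV[R]_m.

Lemma coord_le_norm v c : `|v ord0 c| <= `|v|.
Proof.
rewrite [leRHS]mx_normrE.
exact: (le_bigmax _ (fun i : 'I_1 * 'I_m => `|v i.1 i.2|) (ord0, c)).
Qed.

Lemma norm_le_coord v (b : R) : 0 <= b -> (forall c, `|v ord0 c| <= b) -> `|v| <= b.
Proof.
move=> b0 vb; rewrite [leLHS]mx_normrE; apply: bigmax_le => // -[i c] _ /=.
by rewrite (ord1 i).
Qed.

Lemma edist_le_norm u v (b : R) : `|u - v| <= b -> edist u v <= m%:R * b.
Proof.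
move=> uv; apply: edist_le_coord => [|c]; first by apply: le_trans uv.
by apply: le_trans uv; have := coord_le_norm (u - v) c; rewrite !mxE.
Qed.
End row_norm.

Lemma bounded_funE (R : realType) (T : Type) (m : nat) (g : T -> 'rV[R]_m) :
  bounded_fun g <-> exists b : R, forall x, `|g x| <= b.
Proof.
split=> [/pinfty_ex_gt0[b b0 gb]|[b gb]]; first by exists b => x; exact: gb.
exists b; split; first exact: num_real.
by move=> M bM x _; apply: le_trans (gb x) (ltW bM).
Qed.

(** The intervals of centre [a i] and radius [2 * b i] are nested. *)
Lemma nested_limit (R : realType) (a b : nat -> R) :
  (forall i, 0 <= b i) -> (forall i, `|a i.+1 - a i| <= b i) ->
  (forall i, b i.+1 <= b i / 2) ->
  exists l, forall i, `|a i - l| <= 2 * b i.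
Proof.
move=> b0 ab bb.
pose lo i := a i - 2 * b i; pose hi i := a i + 2 * b i.
have lo_step i : lo i <= lo i.+1.
  by have := ab i; have := bb i; rewrite ler_distl /lo => ? /andP[? ?]; lra.
have hi_step i : hi i.+1 <= hi i.
  by have := ab i; have := bb i; rewrite ler_distl /hi => ? /andP[? ?]; lra.
have lo_mono i j : (i <= j)%N -> lo i <= lo j.
  move=> /subnKC <-; elim: (j - i)%N => [|n IH]; first by rewrite addn0.
  by rewrite addnS (le_trans IH).
have hi_mono i j : (i <= j)%N -> hi j <= hi i.
  move=> /subnKC <-; elim: (j - i)%N => [|n IH]; first by rewrite addn0.
  by rewrite addnS (le_trans _ IH).
have lo_hi i j : lo i <= hi j.
  apply: (le_trans (lo_mono i (maxn i j) (leq_maxl _ _))).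
  apply: (le_trans _ (hi_mono j (maxn i j) (leq_maxr _ _))).
  by rewrite /lo /hi; have := b0 (maxn i j); lra.
have lo_sup : has_sup (range lo).
  by split; [exists (lo 0%N), 0%N|exists (hi 0%N) => _ [i _ <-]].
exists (sup (range lo)) => i.
have h1 : lo i <= sup (range lo) by apply: ub_le_sup; [case: lo_sup|exists i].
have h2 : sup (range lo) <= hi i by apply: ge_sup; [case: lo_sup|move=> _ [j _ <-]].
by rewrite distrC ler_distl; apply/andP; split.
Qed.

Section baire.
Variables (R : realType) (X : topologicalType) (m : nat).
Local Notation C := (bcont R X m).

(** Starting from a point of a given open set, a point [g (i + 1)] of [U i] is
    chosen within [b i] of [g i], and then [b (i + 1)] at most half of [b i], so
    small that the tube of radius [2 * b (i + 1)] about [g (i + 1)] stays in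
    [U i].  The radii are functions on [X], but they are bounded by powers of
    1/2, so the limit is uniform. *)
Lemma source_limitation_baire (U : nat -> set C) :
  (forall i, open (U i)) ->
  (forall i (g : C) (alpha : X -> R), continuous alpha -> (forall x, 0 < alpha x) ->
     exists2 h : C, U i h & forall x, `|h x - g x| <= alpha x) ->
  dense (\bigcap_i U i).
Proof.
move=> Uo Ud W [g0 Wg0]; rewrite source_openE => /(_ g0 Wg0)[a0 [a0c a00 a0W]].
pose tame (b : X -> R) := continuous b /\ forall x, 0 < b x.
have shrink (a b : X -> R) : tame a -> tame b ->
    exists b', [/\ tame b', forall x, b' x <= b x / 2
      & forall x, m%:R * (2 * b' x) <= a x].
  move=> [ac ap] [bc bp].
  exists (fun x => Num.min (b x / 2) (a x / (2 * m.+1%:R))); split.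
  - split=> x; last by rewrite lt_min !divr_gt0 ?mulr_gt0.
    apply: (@continuous_min _ _ (fun x => b x / 2) (fun x => a x / (2 * m.+1%:R)));
      by apply: cvgM; [first [exact: bc|exact: ac]|exact: cvg_cst].
  - by move=> x; rewrite ge_min lexx.
  - move=> x.
    have h : Num.min (b x / 2) (a x / (2 * m.+1%:R)) <= a x / (2 * m.+1%:R).
      by rewrite ge_min lexx orbT.
    apply: (@le_trans _ _ (m%:R * (2 * (a x / (2 * m.+1%:R))))).
      by rewrite ler_wpM2l // ler_wpM2l.
    rewrite (_ : 2 * (a x / (2 * m.+1%:R)) = a x / m.+1%:R); last by field.
    rewrite mulrCA ger_pMr ?ap // ler_pdivrMr // mul1r ler_nat //.
have step (i : nat) (gb : C * (X -> R)) : exists hb : C * (X -> R),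
    tame gb.2 -> [/\ tame hb.2, U i hb.1, forall x, `|hb.1 x - gb.1 x| <= gb.2 x,
      forall x, hb.2 x <= gb.2 x / 2
      & forall h : C, (forall x, `|hb.1 x - h x| <= 2 * hb.2 x) -> U i h].
  case: gb => g b /=; have [tb|] := pselect (tame b); last by exists (g, b).
  have [h Uh hg] := Ud i g b tb.1 tb.2.
  have := Uo i; rewrite source_openE => /(_ h Uh)[a [ac ap aU]].
  have [b' [tb' b'b b'a]] := shrink a b (conj ac ap) tb.
  exists (h, b') => _; split=> // h' hh'; apply: aU => x.
  exact: le_trans (edist_le_norm (hh' x)) (b'a x).
have one_tame : tame (fun=> 1) by split=> [x|x]; [exact: cvg_cst|exact: ltr01].
have [b0 [tb0 b01 b0a]] := shrink a0 (fun=> 1) (conj a0c a00) one_tame.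
have [F FP] := choice (fun igb : nat * (C * (X -> R)) => step igb.1 igb.2).
pose s := fix s i := if i is i'.+1 then F (i', s i') else (g0, b0).
have ts i : tame (s i).2.
  elim: i => // i IH; by have [] := FP (i, s i) IH.
have sP i := FP (i, s i) (ts i).
pose g i : C := (s i).1; pose b i : X -> R := (s i).2.
have b_pos i x : 0 < b i x by have [_ h] := ts i; exact: h.
have b_half i x : b i.+1 x <= b i x / 2 by have [_ _ _ h _] := sP i; exact: h.
have b_small i x : b i x <= (2 ^+ i)^-1.
  elim: i => [|i IH].
    by rewrite expr0 invr1 (le_trans (b01 x)) // ler_pdivrMr // mul1r ler1n.
  by rewrite (le_trans (b_half i x)) // exprSr invfM ler_pM2r // invr_gt0.
have /choice[h hP] : forall x, exists v : 'rV[R]_m,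
    forall i, `|g i x - v| <= 2 * b i x.
  move=> x.
  have /choice[l lP] : forall c, exists l,
      forall i, `|g i x ord0 c - l| <= 2 * b i x.
    move=> c; apply: nested_limit => i //; first exact: ltW.
    have [_ _ /(_ x) gg _ _] := sP i; apply: le_trans gg.
    by have := coord_le_norm (g i.+1 x - g i x) c; rewrite !mxE.
  exists (\row_c l c) => i; apply: norm_le_coord; first by rewrite mulr_ge0 // ltW.
  by move=> c; rewrite !mxE.
have hc : continuous h.
  move=> x; apply/cvgrPdist_lt => e e0.
  have [i ie] : exists i, (2 ^+ i)^-1 < e / 6.
    have e6 : 0 < e / 6 by rewrite divr_gt0.
    exists (Num.truncn (e / 6)^-1).
    rewrite -[ltRHS]invrK ltf_pV2 ?posrE ?exprn_gt0 ?invr_gt0 //.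
    apply: lt_le_trans (truncnS_gt _) _.
    by rewrite -natrX ler_nat ltn_expl.
  have bi y : 2 * b i y < e / 3 by have := b_small i y; lra.
  have gc : g i @ x --> g i x by exact: (bcont_continuous (b := g i)).
  have e3 : 0 < e / 3 by rewrite divr_gt0.
  move/cvgrPdist_lt: gc => /(_ _ e3); apply: filterS => y gxy.
  have h1 := hP x i; have h2 := hP y i.
  have -> : h x - h y = (h x - g i x) + (g i x - g i y) + (g i y - h y).
    by rewrite !subrKA.
  apply: le_lt_trans (ler_normD _ _) _.
  apply: (@le_lt_trans _ _ (`|h x - g i x| + `|g i x - g i y| + `|g i y - h y|)).
    by rewrite lerD2r ler_normD.
  rewrite (distrC (h x)); have := bi x; have := bi y; lra.
have hb : bounded_fun h.
  have /bounded_funE[B gB] := bcont_bounded g0.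
  apply/bounded_funE; exists (B + 2) => x.
  have -> : h x = g0 x - (g0 x - h x) by rewrite opprB addrC subrK.
  apply: le_trans (ler_normB _ _) _; apply: lerD => //.
  have := hP x 0%N; rewrite /g /b /= => /le_trans; apply.
  by have := b_small 0%N x; rewrite expr0 invr1 /b /=; lra.
exists (BCont hc hb); split.
  apply: a0W => x; apply: le_trans (b0a x).
  by apply: edist_le_norm; exact: (hP x 0%N).
move=> i _; have [_ _ _ _] := sP i; apply => x; exact: (hP x i.+1).
Qed.
End baire.

(** * Stability of general position *)

Section stability.
Variables (R : realType) (X Y : topologicalType) (f : X -> Y).
Variables (dX : X -> X -> R) (dY : Y -> Y -> R).
Hypotheses (dXP : compatible_metric dX) (dYP : compatible_metric dY).
Hypothesis f_perfect : perfect_map f.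
Variables (m k : nat) (S : {set 'I_m * 'I_m}) (J : {set 'I_m}) (eps : R).

Definition general_at (h : X -> 'rV[R]_m) (y : Y) : Prop :=
  forall x : 'I_k -> X, (forall j, f (x j) = y) ->
    (forall j j', j != j' -> eps <= dX (x j) (x j')) ->
    ~ aligned S J (fun j => h (x j)).

(** Failures of stability for arbitrarily small [delta] are bad tuples in nearby
    fibres.  Along an ultrafilter on these, the points converge to a tuple in
    the fibre of [y], because [f] is perfect, and the slopes converge
    because they are bounded by 1; the limit tuple is bad for [g]. *)
Lemma general_at_stable (g : X -> 'rV[R]_m) (y : Y) :
  continuous g -> general_at g y ->
  exists2 delta : R, 0 < delta & forall y' h, dY y y' < delta ->
    (forall x, f x = y' -> edist (g x) (h x) <= delta) -> general_at h y'.
Proof.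
move=> gc gy; apply: contrapT => unstable.
pose T := (('I_k -> X) * ('I_k -> 'rV[R]_m) * ('I_m -> 'I_m -> R))%type.
pose A (delta : R) : set T := [set t : T | exists y',
  [/\ dY y y' < delta /\ forall j, f (t.1.1 j) = y',
      forall j c, `|g (t.1.1 j) ord0 c - t.1.2 j ord0 c| <= delta,
      forall j j', j != j' -> eps <= dX (t.1.1 j) (t.1.1 j')
    & [/\ forall c a, `|t.2 c a| <= 1,
          forall c a, (c, a) \notin S -> t.2 c a = 0
        & graph_over J t.2 t.1.2]]].
have A0 delta : 0 < delta -> A delta !=set0.
  move=> d0; apply: contrapT => noA; apply: unstable.
  exists delta => // y' h yy' gh x fx sep [M MP].
  apply: noA; exists (x, (fun j => h (x j)), M), y'; split=> //=.
  by move=> j c; apply: le_trans (coord_le_edist _ _ _) (gh _ (fx j)).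
have Amono d1 d2 : d1 <= d2 -> A d1 `<=` A d2.
  move=> d12 t [y' [[yy' fx] gv sep al]]; exists y'; split=> //.
    by split=> //; apply: lt_le_trans d12.
  by move=> j c; apply: le_trans (gv j c) d12.
have FP : ProperFilter (filter_from [set delta : R | 0 < delta] A).
  apply: filter_from_proper; last by move=> d /A0.
  apply: filter_from_filter; first by exists 1; exact: ltr01.
  move=> d1 d2 /= d10 d20; exists (Num.min d1 d2); first by rewrite /= lt_min d10.
  by move=> t At; split; apply: (Amono _ _ _ _ At); rewrite ge_min lexx ?orbT.
have [G [GU FG]] := ultraFilterLemma FP.
have GP : ProperFilter G := @ultra_proper _ _ GU.
have GA delta : 0 < delta -> G (A delta) by move=> d0; apply: FG; exists delta.
have [fc fcl fcpt] := f_perfect.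
have /choice[x xP] : forall j, exists x,
    f x = y /\ (fun t : T => t.1.1 j) @ G --> x.
  move=> j.
  have [W oW Wsub|x fx ux] := @compact_ultra_limit X (f @^-1` [set y]) T G
      (fun t => t.1.1 j) (fcpt y) GU.
    have /(nbhs_cmetric dYP)[e e0 sub] := closed_map_tube fcl oW Wsub.
    apply: filterS (GA e e0) => t [y' [[yy' fx] _ _ _]] /=.
    by apply: (sub y' yy'); rewrite /= fx.
  by exists x.
have /choice[M MP] : forall ca : 'I_m * 'I_m, exists l : R,
    `|l| <= 1 /\ (fun t : T => t.2 ca.1 ca.2) @ G --> l.
  move=> [c a] /=.
  have [W oW Wsub|l] := @compact_ultra_limit R `[-1, 1] T G (fun t => t.2 c a)
      (@segment_compact R _ _) GU.
    apply: filterS (GA 1 ltr01) => t [y' [_ _ _ [t1 _ _]]] /=.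
    by apply: Wsub; rewrite /= in_itv /= -ler_norml.
  by rewrite /= in_itv /= -ler_norml => l1 ul; exists l.
have vlim j c : (fun t : T => t.1.2 j ord0 c) @ G --> g (x j) ord0 c.
  have glim : (fun t : T => g (t.1.1 j) ord0 c) @ G --> g (x j) ord0 c.
    apply: (@cvg_comp _ _ _ (fun t : T => t.1.1 j) (fun x => g x ord0 c) G
              (nbhs (x j))); first exact: (xP j).2.
    apply: (@cvg_comp _ _ _ g (fun v : 'rV[R]_m => v ord0 c)); first exact: gc.
    exact: coord_continuous.
  apply/cvgrPdist_lt => e e0.
  have e2 : 0 < e / 2 by rewrite divr_gt0.
  move/cvgrPdist_lt : glim => /(_ _ e2) h1.
  apply: filterS (filterI h1 (GA _ e2)) => t [/= lt1 [y' [_ /(_ j c) le2 _ _]]].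
  rewrite -(subrKA (g (t.1.1 j) ord0 c)) (splitr e).
  by apply: le_lt_trans (ler_normD _ _) _; apply: ltr_leD.
have lim_eq (u w : T -> R) (a b : R) : u @ G --> a -> w @ G --> b ->
    G [set t | u t = w t] -> a = b.
  move=> ua wb uw; have wa : u @ G --> b.
    by apply: cvg_trans wb; apply: near_eq_cvg; apply: filterS uw => t /= ->.
  exact: (cvg_unique (@Rhausdorff R) ua wa).
apply: (gy x (fun j => (xP j).1)).
  move=> j j' jj'; rewrite leNgt; apply/negP => lt_eps.
  pose e := (eps - dX (x j) (x j')) / 2.
  have e0 : 0 < e by rewrite divr_gt0 // subr_gt0.
  have h1 : G [set t : T | dX (x j) (t.1.1 j) < e] :=
    (xP j).2 _ (nbhs_cball dXP (x j) e0).
  have h2 : G [set t : T | dX (x j') (t.1.1 j') < e] :=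
    (xP j').2 _ (nbhs_cball dXP (x j') e0).
  have [t [[/= h3 h4] [y' [_ _ /(_ _ _ jj') sep _]]]] :=
    filter_ex (filterI (filterI h1 h2) (GA 1 ltr01)).
  move: sep; apply/negP; rewrite -ltNge.
  have := cmetric_triangle dXP (x j) (t.1.1 j) (t.1.1 j').
  have := cmetric_triangle dXP (x j') (x j) (t.1.1 j').
  by rewrite (cmetric_sym dXP _ (x j)); move: h3 h4; rewrite /e; lra.
exists (fun c a => M (c, a)); split.
- by move=> c a; exact: (MP (c, a)).1.
- move=> c a caS; apply: (lim_eq _ _ _ _ (MP (c, a)).2 (cvg_cst 0)).
  by apply: filterS (GA 1 ltr01) => t [y' [_ _ _ [_ t0 _]]] /=; exact: t0.
move=> j j' c cJ.
apply: (lim_eq (fun t : T => t.1.2 j ord0 c - t.1.2 j' ord0 c)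
  (fun t : T => \sum_(a in J) t.2 c a * (t.1.2 j ord0 a - t.1.2 j' ord0 a))).
- by apply: cvgB; exact: vlim.
- apply: cvg_big => [|a _]; first exact: add_continuous.
  apply: cvgM; first exact: (MP (c, a)).2.
  by apply: cvgB; exact: vlim.
by apply: filterS (GA 1 ltr01) => t [y' [_ _ _ [_ _ al]]] /=; exact: al.
Qed.

Definition general_maps : set (bcont R X m) := [set g | forall y, general_at g y].

(** The radius of stability of [general_at_stable] becomes a continuous function
    on [Y], and hence on [X], through [lipschitz_envelope]. *)
Lemma open_general_maps : open general_maps.
Proof.
rewrite source_openE => g gen.
pose Q y r := forall y' h, dY y y' < r ->
    (forall x, f x = y' -> edist (g x) (h x) <= r) -> general_at h y'.
have [y y' h|y y2 r Qr yr y' h yy' gh|beta [cb bge blt]] :=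
    @lipschitz_envelope _ _ dY dYP Q.
- by rewrite ltNge cmetric_ge0.
- apply: Qr => [|x fx].
    by apply: le_lt_trans (cmetric_triangle dYP y2 _ _) _; lra.
  by apply: le_trans (gh x fx) _; rewrite gerBl cmetric_ge0.
have b0 y : 0 < beta y.
  have [d d0 dP] := general_at_stable (bcont_continuous (b := g)) (gen y).
  apply: (@lt_le_trans _ _ (Num.min d 1)); first by rewrite lt_min d0 ltr01.
  apply: bge; first by rewrite le_min (ltW d0) ler01 ge_min lexx orbT.
  move=> y' h; rewrite lt_min => /andP[yd _] gh; apply: dP => // x fx.
  by apply: le_trans (gh x fx) _; rewrite ge_min lexx.
exists (fun x => beta (f x) / 2); split.
- have [fc _ _] := f_perfect.
  move=> x; apply: cvgM; last exact: cvg_cst.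
  by apply: (@continuous_comp _ _ _ f beta); [exact: fc|exact: cb].
- by move=> x; rewrite divr_gt0.
move=> h gh y.
have /blt[r [rb r1 Qr]] : beta y / 2 < beta y.
  by rewrite ltr_pdivrMr // ltr_pMr // ltr1n.
have r0 : 0 < r by apply: le_lt_trans rb; rewrite divr_ge0 ?(ltW (b0 y)).
apply: (Qr y h); first by rewrite cmetric_xx.
by move=> x fx; apply: le_trans (gh x) _; rewrite fx ltW.
Qed.
End stability.

(** * Zero-dimensional metrizable spaces *)

Lemma card_le_uniq (T : choiceType) (A : set T) (n : nat) (s : seq T) :
  A #<= `I_n -> uniq s -> (forall x, x \in s -> A x) -> (size s <= n)%N.
Proof.
move=> An us sA; apply: leq_trans (geq_card_fset_set An).
apply: uniq_leq_size => // x /sA Ax; rewrite in_fset_set ?inE //.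
by apply/finite_set_leP; exists n.
Qed.

Lemma card_gt_uniq (T : choiceType) (A : set T) (n : nat) :
  ~ (A #<= `I_n) -> exists s : seq T,
    [/\ uniq s, size s = n.+1 & forall x, x \in s -> A x].
Proof.
move=> An.
have build i : (i <= n.+1)%N -> exists s : seq T,
    [/\ uniq s, size s = i & forall x, x \in s -> A x].
  elim: i => [_|i IH lt_in]; first by exists [::].
  have [s [us si sA]] := IH (ltnW lt_in).
  have [x Ax xs] : exists2 x, A x & x \notin s.
    apply: contrapT => no; apply: An.
    have As : A `<=` [set` s].
      by move=> x Ax; apply/negPn/negP => xs; apply: no; exists x.
    apply: card_le_trans (subset_card_le As) _.
    case: s us si sA {no As} => [|x0 s] us si sA.
      by apply: card_le_trans (card_ge0 _ _); apply: subset_card_le => x.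
    have -> : [set` (x0 :: s)] = nth x0 (x0 :: s) @` `I_i.
      apply/seteqP; split=> x /=.
        move=> xs; exists (index x (x0 :: s)); last exact: nth_index.
        by change (index x (x0 :: s) < i)%N; rewrite -si index_mem.
      by move=> [j ji <-]; apply: mem_nth; rewrite si.
    apply: card_le_trans (card_image_le _ _) _.
    by rewrite card_le_II -ltnS.
  exists (x :: s); split; rewrite /= ?xs ?si // => z.
  by rewrite inE => /orP[/eqP->|/sA].
exact: build.
Qed.

Lemma strict_well_order (T : eqType) : exists2 lt : T -> T -> Prop,
  forall a b, a <> b -> lt a b \/ lt b a
  & forall P : set T, P !=set0 -> exists2 a, P a & forall b, P b -> ~ lt b a.
Proof.
have [le le_wo] := wochoice.well_ordering_principle T.
have minP (P : set T) : P !=set0 -> exists2 a, P a & forall b, P b -> le a b.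
  move=> [x Px]; have [|a [[Pa amin] _]] := le_wo (fun x => `[< P x >]).
    by exists x; apply/asboolP.
  exists a; first exact/asboolP.
  by move=> b Pb; apply: amin; apply/asboolP.
have refl a : le a a.
  by have [|b /= -> h] := minP [set a]; [exists a|apply: h].
exists (fun a b => ~~ le b a) => [a b ab|P /minP[a Pa amin]]; last first.
  by exists a => // b /amin ->.
have [lab|_] := boolP (le a b); last by right.
have [lba|_] := boolP (le b a); last by left.
have [|c [_ cuniq]] := le_wo (pred2 a b); first by exists a; rewrite inE /= eqxx.
case: ab; rewrite -(cuniq a) ?(cuniq b) //.
  by split=> [|x]; rewrite ?inE /= ?eqxx ?orbT // => /orP[/eqP->|/eqP->].
by split=> [|x]; rewrite ?inE /= ?eqxx // => /orP[/eqP->|/eqP->].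
Qed.

(** A finite partition into open sets refining the cover by the complements of
    [A] and [B]: [C] is the union of the parts that meet [A]. *)
Lemma zero_dim_separation (Y : topologicalType) (A B : set Y) :
  dim_le Y 0 -> closed A -> closed B -> A `&` B = set0 ->
  exists C : set Y, [/\ open C, closed C, A `<=` C & C `&` B = set0].
Proof.
move=> dim0 Acl Bcl AB0.
have cov : finite_open_cover [set ~` A; ~` B].
  split; first exact: finite_set2.
    by move=> U [->|->]; exact: closed_openC.
  rewrite bigcup_setU !bigcup_set1; apply/seteqP; split=> // y _.
  have [Ay|nAy] := pselect (A y); last by left.
  by right=> By; suff: set0 y by []; rewrite -AB0.
have [D [[_ Dopen Dcov] Dref Dord]] := dim0 _ cov.
have Duniq V V' y : D V -> D V' -> V y -> V' y -> V = V'.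
  move=> DV DV' Vy V'y; apply/eqP; rewrite -[_ == _]negbK; apply/negP => VV'.
  suff : (size [:: V; V'] <= 1)%N by [].
  apply: card_le_uniq (Dord y) _ _; first by rewrite /= inE VV'.
  by move=> W; rewrite !inE => /orP[/eqP->|/eqP->].
pose C := \bigcup_(V in D `&` [set V | V `&` A !=set0]) V.
have Cc : ~` C = \bigcup_(V in D `&` [set V | V `&` A = set0]) V.
  apply/seteqP; split=> y.
    move=> nCy; have : [set: Y] y by [].
    rewrite -Dcov => -[V DV Vy]; exists V => //; split=> //=.
    apply/eqP/negPn/negP => /set0P VA; apply: nCy; exists V => //; split=> //.
  move=> [V [DV /= VA0] Vy] [V' [DV' /= [a [V'a Aa]]] V'y].
  by suff: set0 a by []; rewrite -VA0 (Duniq V V' y).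
exists C; split.
- by apply: bigcup_open => V [/Dopen].
- rewrite -[C]setCK Cc; apply/open_closedC/bigcup_open => V [/Dopen //].
- move=> a Aa; have : [set: Y] a by [].
  rewrite -Dcov => -[V DV Va]; exists V => //; split=> //.
  by exists a.
- apply/seteqP; split=> // y [[V [DV [a [Va Aa]]] Vy] By].
  by have [U [->|->] VU] := Dref V DV; [exact: (VU a Va)|exact: (VU y Vy)].
Qed.

Section ultraparacompact.
Variables (R : realType) (Y : topologicalType) (d : Y -> Y -> R).
Hypotheses (dY : compatible_metric d) (dim0 : dim_le Y 0).

(** Every open cover of [Y] is refined by a partition into open sets.  Well-order
    the cover.  The core [F i s] consists of the points for which [s] is the
    first index of a member containing them, and which lie deep in that member,
    at scale [1 / (i + 1)].  For a fixed [i] the cores are uniformly separated,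
    so their disjoint neighbourhoods [B i s] form a discrete family, and
    [zero_dim_separation] puts a clopen set [C i] between the union of the cores
    and that of the neighbourhoods.  A point belongs to the part given by the
    first [C i] that contains it and by the [B i s] in which it lies. *)
Lemma locally_constant_selection (V : Y -> set Y) :
  (forall y, nbhs y (V y)) ->
  exists s : Y -> Y, (forall y, V (s y) y) /\
    (forall y, \forall y' \near y, s y' = s y).
Proof.
move=> Vn.
have [lt lt_tot lt_min] := strict_well_order Y.
pose U y := (V y)^°.
have Uo y : open (U y) by exact: open_interior.
have UV y : U y `<=` V y by exact: interior_subset.
have Uy y : U y y by exact: Vn.
pose w (i : nat) : R := i.+1%:R^-1.
have w0 i : 0 < w i by rewrite invr_gt0.
pose F (i : nat) (s : Y) : set Y :=
  [set y | (forall z, d y z < 3 * w i -> U s z) /\ forall s', lt s' s -> ~ U s' y].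
have Fsep i s s' y y' : s <> s' -> F i s y -> F i s' y' -> 3 * w i <= d y y'.
  wlog lts : s s' y y' / lt s s'.
    move=> wl ss' Fy Fy'; have [l|l] := lt_tot s s' ss'; first exact: (wl s s').
    by rewrite (cmetric_sym dY); apply: (wl s' s) => // e; apply: ss'.
  move=> _ [Fy _] [_ /(_ _ lts) nUy']; rewrite leNgt; apply/negP => yy'.
  exact/nUy'/Fy.
have Fcover y : exists i s, F i s y.
  have [s Usy smin] := lt_min [set s | U s y] (ex_intro (fun s => U s y) y (Uy y)).
  have /(nbhs_cmetric dY)[e e0 eU] : nbhs y (U s) by exact: open_nbhs_nbhs.
  have [i] : exists i, 3 / e < i.+1%:R.
    exists (Num.truncn (3 / e)); exact: truncnS_gt.
  move=> ie; exists i, s; split=> [z yz|s' s's Us'y]; last exact: smin s's.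
  apply: eU; apply: lt_trans yz _.
  by rewrite /w ltr_pdivrMr // mulrC -ltr_pdivrMr.
pose B i s := [set y | exists2 z, F i s z & d z y < w i].
have Bo i s : open (B i s).
  rewrite openE => y [z Fz zy]; apply/(nbhs_cmetric dY).
  exists (w i - d z y); first by rewrite subr_gt0.
  move=> y' yy'; exists z => //.
  by apply: le_lt_trans (cmetric_triangle dY y _ _) _; lra.
have Bdisj i s s' y : B i s y -> B i s' y -> s = s'.
  move=> [z Fz zy] [z' Fz' z'y]; apply: contrapT => /Fsep/(_ Fz Fz').
  have := cmetric_triangle dY y z z'; rewrite (cmetric_sym dY y z').
  by have := w0 i; lra.
have BU i s : B i s `<=` U s.
  by move=> y [z [Fz _] zy]; apply: Fz; have := w0 i; lra.
have /choice[C CP] : forall i, exists C : set Y,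
    [/\ open C, closed C, \bigcup_s F i s `<=` C & C `<=` \bigcup_s B i s].
  move=> i.
  have cl1 : closed (closure (\bigcup_s F i s)) by exact: closed_closure.
  have cl2 : closed (~` \bigcup_s B i s).
    by apply: open_closedC; apply: bigcup_open => s _.
  have [|C [Co Cc AC CB]] := zero_dim_separation dim0 cl1 cl2.
    apply/seteqP; split=> // y [cly nBy].
    have [z [[s _ Fz] /= yz]] := cly _ (nbhs_cball dY y (w0 i)).
    by apply: nBy; exists s => //; exists z => //; rewrite (cmetric_sym dY).
  exists C; split=> //.
    by apply: subset_trans AC; exact: subset_closure.
  by move=> y Cy; apply: contrapT => nB; suff: set0 y by []; rewrite -CB.
have Ccover y : exists i, C i y.
  have [i [s Fy]] := Fcover y; exists i.
  by have [_ _ sub _] := CP i; apply: sub; exists s.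
pose idx y := ex_minn (P := fun i => `[< C i y >])
  (let: ex_intro i Ci := Ccover y in ex_intro _ i (asboolT Ci)).
have idxP y : C (idx y) y /\ forall i, C i y -> (idx y <= i)%N.
  rewrite /idx; case: ex_minnP => i /asboolP Ci imin; split=> // i' Ci'.
  by apply: imin; apply/asboolP.
have /choice[s sP] : forall y, exists s, B (idx y) s y.
  move=> y; have [_ _ _ sub] := CP (idx y).
  by have [s _ Bs] := sub _ (idxP y).1; exists s.
exists s; split=> [y|y]; first exact/UV/BU/sP.
have near_idx : \forall y' \near y, idx y' = idx y.
  have near1 : \forall y' \near y, C (idx y) y'.
    have [Co _ _ _] := CP (idx y); apply: open_nbhs_nbhs; split=> //.
    exact: (idxP y).1.
  have near2 : forall N, (N <= idx y)%N ->
      \forall y' \near y, forall i, (i < N)%N -> ~ C i y'.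
    elim=> [_|N IH Ny]; first by apply: filterS filterT => y' _ i.
    have nC : nbhs y (~` C N).
      have [_ Cc _ _] := CP N; apply: open_nbhs_nbhs.
      split; first exact: closed_openC.
      by move=> /(idxP y).2; rewrite leqNgt Ny.
    apply: filterS (filterI nC (IH (ltnW Ny))) => y' [nCN nCi] i.
    by rewrite ltnS leq_eqVlt => /orP[/eqP->|/nCi].
  apply: filterS (filterI near1 (near2 _ (leqnn _))) => y' [Cy' nCy'].
  apply/eqP; rewrite eqn_leq (idxP y').2 //= leqNgt; apply/negP => lt_i.
  exact: nCy' lt_i (idxP y').1.
have near_B : nbhs y (B (idx y) (s y)) by apply: open_nbhs_nbhs; split.
apply: filterS (filterI near_idx near_B) => y' [e By'].
by apply: (Bdisj (idx y) _ _ y') => //; rewrite -e.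
Qed.
End ultraparacompact.

(** * Approximation through nerves *)

Lemma compact_lower_bound (R : realType) (X : topologicalType) (K : set X)
    (phi : X -> R) :
  compact K -> continuous phi -> (forall x, K x -> 0 < phi x) ->
  exists2 c : R, 0 < c & forall x, K x -> c <= phi x.
Proof.
move=> Kc phic phi0.
have [|s [sK cov]] :=
    @compact_finite_cover X K (fun x => [set x' | phi x / 2 < phi x']) Kc.
  move=> x Kx; apply: (cvgr_gt (phi x) (phic x)).
  by rewrite ltr_pdivrMr // ltr_pMr ?phi0 // ltr1n.
have [c c0 cs] : exists2 c : R, 0 < c & forall x, x \in s -> c <= phi x / 2.
  elim: s sK {cov} => [|x s IH] sK; first by exists 1.
  have [c c0 cs] := IH (fun y ys => sK y (@mem_behead _ (x :: s) y ys)).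
  exists (Num.min c (phi x / 2)).
    by rewrite lt_min c0 divr_gt0 //; apply/phi0/sK/mem_head.
  move=> y; rewrite inE => /orP[/eqP->|/cs cy]; first by rewrite ge_min lexx orbT.
  by rewrite ge_min cy.
exists c => // x /cov[y ys /= yx].
exact: le_trans (cs y ys) (ltW yx).
Qed.

Section nerve.
Variables (R : realType) (X : topologicalType) (K : set X) (n : nat).
Variable (d : X -> X -> R).
Hypotheses (dX : compatible_metric d) (Kc : compact K).
Hypothesis dimK : dim_le (set_type K) n.

(** The functions are defined on the whole of [X], although the dimension of [K]
    controls their number only on [K]: each member of a cover of [K], no point
    of which lies in more than [n + 1] members, is the trace of an open set of
    [X], and [psi i] is a bump function of that open set. *)
Lemma small_bumps (O : X -> set X) : (forall x, K x -> nbhs x (O x)) ->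
  exists (N : nat) (psi : 'I_N -> X -> R) (a : 'I_N -> X),
    [/\ forall i, continuous (psi i), forall i x, 0 <= psi i x,
        forall i x, 0 < psi i x -> O (a i) x,
        forall x, K x -> exists i, 0 < psi i x
      & forall x, K x -> (#|[pred i | (0 < psi i x)%R]| <= n.+1)%N].
Proof.
move=> On.
have [s [sK cov]] := @compact_finite_cover X K (fun x => (O x)^°) Kc
  (fun x Kx => nbhs_interior (On x Kx)).
pose C : set (set (set_type K)) := [set set_val @^-1` (O x)^° | x in [set` s]].
have Ccov : finite_open_cover C.
  split.
  - by apply: finite_image; apply/finite_seqP; exists s.
  - move=> _ [x xs <-]; apply: open_comp; last exact: open_interior.
    by move=> z _; apply: initial_continuous.
  - apply/seteqP; split=> // z _; have [y ys yz] := cov (set_val z) (set_valP z).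
    by exists (set_val @^-1` (O y)^°) => //; exists y.
have [D [[/finite_seqP[sq0 Dsq0] Dopen Dcov] Dref Dord]] := dimK Ccov.
pose sq := undup sq0; pose N := size sq.
pose V (i : 'I_N) : set (set_type K) := nth set0 sq i.
have DE U : D U <-> U \in sq by rewrite Dsq0 /sq mem_undup.
have DV i : D (V i) by apply/DE/mem_nth.
have /choice[W WP] : forall i : 'I_N, exists Wa : set X * X,
    [/\ open Wa.1, Wa.1 `<=` O Wa.2 & V i = set_val @^-1` Wa.1].
  move=> i; have [U [a as_ <-] VU] := Dref _ (DV i).
  have [W0 oW0 W0V] := Dopen _ (DV i).
  exists (W0 `&` (O a)^°, a); split=> /=.
  - by apply: openI => //; exact: open_interior.
  - by move=> x [_ /interior_subset].
  - rewrite -W0V; apply/seteqP; split=> z; last by case.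
    by move=> W0z; split=> //; apply: (VU z); rewrite -W0V.
have /choice[psi psiP] : forall i : 'I_N, exists psi : X -> R,
   [/\ continuous psi, forall x, 0 <= psi x & forall x, 0 < psi x <-> (W i).1 x].
  by move=> i; have [oW _ _] := WP i; exact: (open_bump dX oW).
have psiV i (z : set_type K) : 0 < psi i (set_val z) <-> V i z.
  by have [_ _ ->] := WP i; have [_ _ h] := psiP i; exact: h.
exists N, psi, (fun i => (W i).2); split.
- by move=> i; have [h _ _] := psiP i; exact: h.
- by move=> i; have [_ h _] := psiP i; exact: h.
- by move=> i x; have [_ _ h] := psiP i; have [_ WO _] := WP i => /h /WO.
- move=> x Kx; pose z : set_type K := exist _ x (mem_set Kx).
  have : [set: set_type K] z by [].
  rewrite -Dcov => -[U /DE Usq Uz].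
  have Ui : (index U sq < N)%N by rewrite index_mem.
  exists (Ordinal Ui); apply/(psiV (Ordinal Ui) z).
  by rewrite /V /= nth_index.
- move=> x Kx; pose z : set_type K := exist _ x (mem_set Kx).
  rewrite cardE -(size_map V); apply: card_le_uniq (Dord z) _ _.
    rewrite map_inj_uniq ?enum_uniq // => i j /eqP.
    by rewrite /V nth_uniq ?undup_uniq // => /eqP/val_inj.
  move=> U /mapP[i]; rewrite mem_enum inE => /(psiV i z) Vz ->.
  by split.
Qed.
End nerve.

Section density.
Variables (R : realType) (X Y : topologicalType) (f : X -> Y).
Variables (dX : X -> X -> R) (dY : Y -> Y -> R).
Hypotheses (dXP : compatible_metric dX) (dYP : compatible_metric dY).
Hypothesis f_perfect : perfect_map f.
Variables (n m k : nat) (S : {set 'I_m * 'I_m}) (J : {set 'I_m}) (eps : R).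
Hypothesis dim_f : map_dim_le f n.
Hypothesis count : (k * n + k * #|J| + (m - #|J|) + #|S| < k * m)%N.
Hypothesis eps0 : 0 < eps.

(** On the fibre, [h] sends a point to the combination of generic vertices
    [p i], close to the values of [g] on the [i]-th set of the cover, with the
    normalised bump functions as barycentric coordinates.  Sets of diameter less
    than [eps] make the carriers of points [eps] apart disjoint. *)
Lemma fiber_general_approximation (g : bcont R X m) (alpha : X -> R) (y : Y) :
  continuous alpha -> (forall x, 0 < alpha x) ->
  exists2 h : bcont R X m, general_at f dX k S J eps h y
    & forall x, f x = y -> `|h x - g x| < alpha x.
Proof.
move=> ac a0; have [fc fcl fcpt] := f_perfect.
have [e e0 ea] := compact_lower_bound (fcpt y) ac (fun x _ => a0 x).
have e4 : 0 < e / 4 by rewrite divr_gt0.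
pose O x := [set x' | dX x x' < eps / 2 /\ `|g x - g x'| < e / 4].
have On x : f x = y -> nbhs x (O x).
  move=> _; apply: filterI; first by apply: nbhs_cball; rewrite // divr_gt0.
  have gc : g @ x --> g x by exact: (bcont_continuous (b := g)).
  by move/cvgrPdist_lt : gc => /(_ _ e4).
have [N [psi [a [psic psi0 psiO psi_cov psi_ord]]]] :=
  small_bumps dXP (fcpt y) (dim_f (y := y)) On.
have [p [pq p_gen]] := generic_vertices (fun i => g (a i)) e4 count.
pose Psi x := \sum_i psi i x.
have Psic : continuous Psi.
  by move=> x; apply: cvg_big => [|i _]; [exact: add_continuous|exact: psic].
have Psi_gt0 x : f x = y -> 0 < Psi x.
  move=> fx; have [i ix] := psi_cov x fx.
  by rewrite /Psi (bigD1 i) //= ltr_wpDr // sumr_ge0.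
have [c c0 cPsi] := compact_lower_bound (fcpt y) Psic Psi_gt0.
(* The maximum keeps the quotients continuous off the fibre, where the bump
   functions may all vanish; on the fibre it is Psi. *)
pose den x := Num.max (Psi x) c.
have den0 x : 0 < den x by rewrite lt_max c0 orbT.
have denc : continuous den.
  move=> x; apply: (@continuous_max _ _ Psi (fun=> c)); first exact: Psic.
  exact: cvg_cst.
pose h x := \sum_i (psi i x / den x) *: p i.
have hc : continuous h.
  move=> x; apply: cvg_big => [|i _]; first exact: add_continuous.
  apply: cvgZ; last exact: cvg_cst.
  apply: cvgM; first exact: psic.
  by apply: cvgV; [rewrite gt_eqF|exact: denc].
have hb : bounded_fun h.
  apply/bounded_funE; exists (\sum_i `|p i|) => x.
  apply: le_trans (ler_norm_sum _ _ _) _; apply: ler_sum => i _.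
  rewrite normrZ ler_piMl // ger0_norm ?divr_ge0 ?(ltW (den0 x)) //.
  rewrite ler_pdivrMr // mul1r le_max; apply/orP; left.
  by rewrite /Psi (bigD1 i) //= lerDl sumr_ge0.
pose lam x i := psi i x / Psi x.
have hE x : f x = y -> h x = \sum_i lam x i *: p i.
  by move=> fx; rewrite /h /lam /den max_l // cPsi.
have lam0 x i : f x = y -> 0 <= lam x i.
  by move=> fx; rewrite divr_ge0 // ltW // Psi_gt0.
have lam1 x : f x = y -> \sum_i lam x i = 1.
  by move=> fx; rewrite -mulr_suml divff // gt_eqF // Psi_gt0.
have lam_psi x i : lam x i != 0 -> 0 < psi i x.
  move=> li; rewrite lt_neqAle psi0 andbT eq_sym; apply: contra li => /eqP p0.
  by rewrite /lam p0 mul0r.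
exists (BCont hc hb) => [x fx sep|x fx] /=.
  have -> : (fun j => h (x j)) = (fun j => \sum_i lam (x j) i *: p i).
    by apply/funext => j; rewrite hE.
  apply: p_gen; split.
  - by move=> j i; apply: lam0.
  - by move=> j; apply: lam1.
  - move=> j; apply: leq_trans (psi_ord _ (fx j)); apply: subset_leq_card.
    by apply/fintype.subsetP => i; rewrite !inE; exact: lam_psi.
  - move=> i j j' /lam_psi/psiO[/= d1 _] /lam_psi/psiO[/= d2 _].
    apply/eqP/negPn/negP => /sep; apply/negP; rewrite -ltNge.
    apply: le_lt_trans (cmetric_triangle dXP (a i) _ _) _.
    by rewrite (cmetric_sym dXP _ (a i)) (splitr eps) ltrD.
rewrite hE //.
have -> : \sum_i lam x i *: p i - g x = \sum_i lam x i *: (p i - g x).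
  under [RHS]eq_bigr do rewrite scalerBr.
  by rewrite sumrB -scaler_suml lam1 // scale1r.
apply: (@le_lt_trans _ _ (e / 2)); last first.
  by apply: lt_le_trans (ea x fx); rewrite ltr_pdivrMr // ltr_pMr // ltr1n.
apply: le_trans (ler_norm_sum _ _ _) _.
have -> : e / 2 = (\sum_i lam x i) * (e / 2) by rewrite lam1 ?mul1r.
rewrite mulr_suml; apply: ler_sum => i _.
rewrite normrZ ger0_norm ?lam0 //.
have [->|li] := eqVneq (lam x i) 0; first by rewrite !mul0r.
apply: ler_wpM2l; first exact: lam0.
have [_ ga] := psiO i x (lam_psi x i li).
rewrite -(subrKA (g (a i))); apply: le_trans (ler_normD _ _) _.
rewrite (_ : e / 2 = e / 4 + e / 4); last by field.
apply: lerD; last exact: ltW.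
by apply: norm_le_coord => [|c']; [exact: ltW|rewrite !mxE].
Qed.

(** The approximations of [fiber_general_approximation] for the various fibres
    remain valid over neighbourhoods [V y] and are glued by
    [locally_constant_selection].  Capping [alpha] at 1 keeps the glued map
    bounded. *)
Lemma general_maps_dense (dim_Y : dim_le Y 0) (g : bcont R X m) (alpha : X -> R) :
  continuous alpha -> (forall x, 0 < alpha x) ->
  exists2 h : bcont R X m, general_maps f dX k S J eps h
    & forall x, `|h x - g x| <= alpha x.
Proof.
move=> alphac alpha0; have [fc fcl fcpt] := f_perfect.
pose a x := Num.min (alpha x) 1.
have ac : continuous a.
  move=> x; apply: (@continuous_min _ _ alpha (fun=> 1)); first exact: alphac.
  exact: cvg_cst.
have a0 x : 0 < a x by rewrite lt_min alpha0 ltr01.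
have /choice[H HP] : forall y, exists h : bcont R X m,
    general_at f dX k S J eps h y /\ forall x, f x = y -> `|h x - g x| < a x.
  by move=> y; have [h h1 h2] := fiber_general_approximation g y ac a0; exists h.
pose V y := [set y' | general_at f dX k S J eps (H y) y' /\
                      forall x, f x = y' -> `|H y x - g x| < a x].
have [y|s [sV sloc]] := locally_constant_selection dYP dim_Y (V := V).
  have [Hy Ha] := HP y; apply: filterI.
    have [d d0 dP] :=
      general_at_stable dXP dYP f_perfect (bcont_continuous (b := H y)) Hy.
    apply/(nbhs_cmetric dYP); exists d => // y' yy'; apply: dP => // x _.
    apply: le_trans (ltW d0); rewrite /Defs.edist big1 ?sqrtr0 // => i _.
    by rewrite subrr expr0n.
  pose phi x := a x - `|H y x - g x|.
  have phic : continuous phi.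
    move=> x; apply: cvgB; first exact: ac.
    apply: cvg_norm; apply: cvgB; exact: bcont_continuous.
  have oW : open [set x | 0 < phi x].
    apply: (@open_comp _ _ phi [set r | 0 < r]) => [x _|]; first exact: phic.
    exact: open_gt.
  have := @closed_map_tube X Y f y _ fcl oW.
  have sub : f @^-1` [set y] `<=` [set x | 0 < phi x].
    by move=> x fx /=; rewrite subr_gt0; exact: Ha.
  move=> /(_ sub); apply: filterS => y' sub' x fx.
  by have := sub' x fx; rewrite /= subr_gt0.
pose h x := H (s (f x)) x.
have ha x : `|h x - g x| < a x by have [_ hh] := sV (f x); exact: hh.
have hc : continuous h.
  move=> x.
  have Hc : H (s (f x)) @ x --> h x by exact: (bcont_continuous (b := H (s (f x)))).
  apply: cvg_trans Hc; apply: near_eq_cvg.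
  have near_s : \forall x' \near x, s (f x') = s (f x) := fc x _ (sloc (f x)).
  by apply: filterS near_s => x' e; rewrite /h e.
have hb : bounded_fun h.
  have /bounded_funE[B gB] := bcont_bounded g.
  apply/bounded_funE; exists (1 + B) => x; rewrite -(subrK (g x) (h x)).
  apply: le_trans (ler_normD _ _) _; apply: lerD => //.
  by apply: le_trans (ltW (ha x)) _; rewrite ge_min lexx orbT.
exists (BCont hc hb) => [y x fx sep|x] /=; last first.
  by apply: le_trans (ltW (ha x)) _; rewrite ge_min lexx.
have -> : (fun j => h (x j)) = (fun j => H (s y) (x j)).
  by apply/funext => j; rewrite /h fx.
by have [gen _] := sV y; exact: gen.
Qed.
End density.

(** * Counting the points of a fibre on a plane *)

(** Here [D] is the dimension of the plane and [e] the number of free slopes.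
    Since [m - n - D] is positive, the count of parameters bounds the number of
    points by a quotient, and [k] is its integer part. *)
Lemma quotient_count (m n D e : nat) : (n + D < m)%N ->
  exists k : nat, (k.+1 * n + k.+1 * D + (m - D) + e < k.+1 * m)%N /\
    (k%:R : rat) <= (m%:R - D%:R + e%:R) / (m%:R - n%:R - D%:R).
Proof.
move=> nDm; pose a := (m - (n + D))%N; have a0 : (0 < a)%N by rewrite subn_gt0.
have mE : m = (n + D + a)%N by rewrite subnKC // ltnW.
exists ((m - D + e) %/ a)%N; set k := (_ %/ _)%N; split.
  have h : (m - D + e < k.+1 * a)%N := ltn_ceil _ a0.
  have -> : (k.+1 * m = k.+1 * n + k.+1 * D + k.+1 * a)%N by rewrite {1}mE !mulnDr.
  by rewrite -addnA ltn_add2l.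
have -> : (m%:R - n%:R - D%:R : rat) = a%:R by rewrite {1}mE !natrD; ring.
have -> : (m%:R - D%:R + e%:R : rat) = (m - D + e)%:R.
  by rewrite natrD natrB // ltnW // (leq_ltn_trans _ nDm) // leq_addl.
by rewrite ler_pdivlMr ?ltr0n // -natrM ler_nat leq_trunc_div.
Qed.

Lemma direction_uniq (R : realType) (m : nat) (P : set 'rV[R]_m)
    (V W : {vspace 'rV[R]_m}) :
  has_direction P V -> has_direction P W -> V = W.
Proof.
have sub (V' W' : {vspace 'rV[R]_m}) :
    has_direction P V' -> has_direction P W' -> (V' <= W')%VS.
  move=> [p ->] [q pq]; apply/subvP => v vV.
  have [w0 w0W e0] : [set q + w | w in [set` W']] p.
    by rewrite -pq; exists 0; [exact: mem0v|rewrite addr0].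
  have [w1 w1W e1] : [set q + w | w in [set` W']] (p + v) by rewrite -pq; exists v.
  rewrite -[v](addKr p) -e1 -e0 opprD addrACA addNr add0r addrC.
  exact: memvB.
by move=> PV PW; apply/eqP; rewrite eqEsubv !sub.
Qed.

Lemma direction_sub (R : realType) (m : nat) (P : set 'rV[R]_m)
    (V : {vspace 'rV[R]_m}) u v :
  has_direction P V -> P u -> P v -> u - v \in V.
Proof.
move=> [p ->] [a aV <-] [b bV <-].
by rewrite opprD addrACA subrr add0r; exact: memvB.
Qed.

Section fibers.
Variables (R : realType) (X Y : topologicalType) (f : X -> Y) (d : X -> X -> R).
Hypothesis dX : compatible_metric d.
Variables (m : nat) (g : X -> 'rV[R]_m).

(** Finitely many distinct points are [1 / (i + 1)] apart for some [i]. *)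
Lemma distinct_not_aligned (k : nat) (S : {set 'I_m * 'I_m}) (J : {set 'I_m})
    (y : Y) (x : 'I_k -> X) :
  (forall i, general_at f d k S J i.+1%:R^-1 g y) ->
  injective x -> (forall j, f (x j) = y) -> ~ aligned S J (fun j => g (x j)).
Proof.
move=> gen x_inj fx.
pose e := \big[Num.min/1]_(p : 'I_k * 'I_k | p.1 != p.2) d (x p.1) (x p.2).
have e0 : 0 < e.
  apply: lt_bigmin => // p ne; apply: (cmetric_gt0 dX) => /x_inj.
  by apply/eqP.
have ie : (Num.truncn e^-1).+1%:R^-1 <= e.
  by rewrite -[leRHS]invrK lef_pV2 ?posrE ?invr_gt0 // ltW // truncnS_gt.
apply: (gen (Num.truncn e^-1) x fx) => j j' ne; apply: le_trans ie _.
exact: (bigmin_le_cond _ (fun p : 'I_k * 'I_k => d (x p.1) (x p.2)) (j := (j, j'))).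
Qed.

Lemma at_most_aligned (k : nat) (S : {set 'I_m * 'I_m}) (J : {set 'I_m}) (y : Y)
    (P : set 'rV[R]_m) (q : rat) :
  (forall i, general_at f d k.+1 S J i.+1%:R^-1 g y) ->
  (forall z : 'I_k.+1 -> 'rV[R]_m, (forall j, P (z j)) -> aligned S J z) ->
  k%:R <= q -> at_most (f @^-1` [set y] `&` g @^-1` P) q.
Proof.
move=> gen PS kq; exists k => //; apply: contrapT => /card_gt_uniq[s [us ss sA]].
have [x0 _] : exists x0, x0 \in s.
  by case: s ss {us sA} => // x s _; exists x; rewrite mem_head.
have xA (j : 'I_k.+1) : (f @^-1` [set y] `&` g @^-1` P) (nth x0 s j).
  by apply/sA/mem_nth; rewrite ss.
apply: (@distinct_not_aligned k.+1 S J y (fun j => nth x0 s j)) => //.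
- move=> j j' /eqP; rewrite nth_uniq ?ss // => /eqP; exact: val_inj.
- by move=> j; have [] := xA j.
- by apply: PS => j; have [] := xA j.
Qed.
End fibers.

Lemma fiber_bound_steep (m n d t T : nat) :
  (m%:R - n%:R - T%:R) * (d%:R - t%:R) <= n%:R :> rat ->
  (n + d < m)%N -> (t <= d <= T)%N ->
  fiber_bound m n d t T =
  (m%:R - d%:R + ((T - d) * (d - t))%:R) / (m%:R - n%:R - d%:R).
Proof.
move=> c ndm /andP[td dT]; rewrite /fiber_bound c natrM !natrB //.
have nz : m%:R - n%:R - d%:R != 0 :> rat.
  have : (n + d)%:R < m%:R :> rat by rewrite ltr_nat.
  by rewrite natrD => h; apply: lt0r_neq0; lra.
by field.
Qed.

(** As [d - t >= 0], the hypothesis forces [m - n - T > 0]. *)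
Lemma fiber_bound_flat (m n d t T : nat) :
  n%:R < (m%:R - n%:R - T%:R) * (d%:R - t%:R) :> rat -> (t <= d)%N ->
  (n + T < m)%N /\
  fiber_bound m n d t T = (m%:R - T%:R + 0%:R) / (m%:R - n%:R - T%:R).
Proof.
move=> c td.
have dt0 : 0 <= d%:R - t%:R :> rat by rewrite subr_ge0 ler_nat.
have a0 : 0 < m%:R - n%:R - T%:R :> rat.
  rewrite ltNge; apply/negP => a0; have : 0 <= n%:R :> rat by [].
  have := mulr_le0_ge0 a0 dt0; lra.
split; first by rewrite -(ltr_nat rat) natrD; lra.
rewrite /fiber_bound leNgt c /=; field.
exact: lt0r_neq0.
Qed.

Theorem theorem1p5 (R : realType) (X Y : topologicalType) (f : X -> Y)
    (n m : nat) (m_ge1 : (1 <= m)%N)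
    (X_metrizable : metrizable R X) (Y_metrizable : metrizable R Y)
    (f_perfect : perfect_map f)
    (dim_f : map_dim_le f n) (dim_Y : dim_le Y 0) :
  exists K : set (bcont R X m),
    [/\ dense K, Gdelta K
      & forall g : bcont R X m, K g ->
        forall d t T : nat,
          (t <= d)%N -> (d <= T)%N -> (T <= m)%N ->
          d%:Z <= m%:Z - n%:Z - 1 ->
        forall (P : set 'rV[R]_m) (Pt PT : {vspace 'rV[R]_m}),
          is_plane d P ->
          is_coordinate_plane t Pt -> is_coordinate_plane T PT ->
          (Pt <= PT)%VS -> parallel_to P Pt PT ->
        forall y : Y,
          at_most (f @^-1` [set y] `&` g @^-1` P) (fiber_bound m n d t T)].
Proof.
have [dX dXP] := metrizable_metric X_metrizable.
have [dY dYP] := metrizable_metric Y_metrizable.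
pose index := ({set 'I_m * 'I_m} * {set 'I_m} * nat * nat)%type.
pose U (c : index) : set (bcont R X m) := let: (E, J, k, i) := c in
  if (k * n + k * #|J| + (m - #|J|) + #|E| < k * m)%N
  then general_maps f dX k E J i.+1%:R^-1 else setT.
have Uo c : open (U c).
  case: c => [[[S J] k] i] /=; case: ifP => _; last exact: openT.
  exact: (open_general_maps dXP dYP f_perfect).
have Ud c (g : bcont R X m) (alpha : X -> R) : continuous alpha ->
    (forall x, 0 < alpha x) -> exists2 h, U c h & forall x, `|h x - g x| <= alpha x.
  move=> ac a0; case: c => [[[S J] k] i] /=; case: ifP => [count|_]; last first.
    by exists g => // x; rewrite subrr normr0 ltW.
  have i0 : 0 < i.+1%:R^-1 :> R by rewrite invr_gt0.
  exact: (general_maps_dense dXP dYP f_perfect dim_f count i0 dim_Y).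
pose F (j : nat) := if unpickle j is Some c then U c else setT.
have Fo j : open (F j).
  by rewrite /F; case: unpickle => [c|]; [exact: Uo|exact: openT].
have FU g c : (\bigcap_j F j) g -> U c g.
  by move=> /(_ (pickle c) I); rewrite /F pickleK.
exists (\bigcap_j F j); split; last move=> g Kg.
- apply: source_limitation_baire => // j g alpha ac a0.
  rewrite /F; case: unpickle => [c|]; first exact: Ud.
  by exists g => // x; rewrite subrr normr0 ltW.
- by exists F.
move=> d t T td dT Tm dmn P Pt PT [V dimV PV] [At cAt PtE] [AT cAT PTE] PtPT.
move=> [V' PV' /andP[PtV' V'PT]] y.
have ndm : (n + d < m)%N by lia.
have eV := direction_uniq PV' PV; rewrite {}eV {V' PV'} in PtV' V'PT.
rewrite {}PtE {}PTE {Pt PT PtPT} in PtV' V'PT.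
rewrite -/(@coordinate_span R m At) -/(@coordinate_span R m AT) in PtV' V'PT.
have gen (S : {set 'I_m * 'I_m}) (J : {set 'I_m}) (k : nat) :
    (k * n + k * #|J| + (m - #|J|) + #|S| < k * m)%N ->
    forall i, general_at f dX k S J i.+1%:R^-1 g y.
  by move=> count i; have := FU g (S, J, k, i) Kg; rewrite /U count; apply.
have [steep|flat] := leP ((m%:R - n%:R - T%:R) * (d%:R - t%:R)) (n%:R : rat).
  have [J [AtJ JAT cJ [M [M1 M0 MV]]]] := parallel_chart PtV' V'PT.
  rewrite dimV in cJ.
  rewrite fiber_bound_steep ?td //.
  have [k [count kq]] := quotient_count ((T - d) * (d - t)) ndm.
  apply: (at_most_aligned dXP (k := k) (J := J)
            (S := finset.setX (AT :\: J) (J :\: At)) _ _ kq).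
    apply: gen; rewrite cardsX !cardsD.
    by rewrite (finset.setIidPr JAT) (finset.setIidPr AtJ) cAT cJ cAt.
  move=> z Pz; exists M; split=> // j j' c cJ'.
  have zz := direction_sub PV (Pz j) (Pz j').
  have := MV _ c zz cJ'; rewrite !mxE => ->.
  by apply: eq_bigr => a _; rewrite !mxE.
(* P is contained in a translate of the coordinate T-plane, which has no slope. *)
have [nTm ->] := fiber_bound_flat flat td.
have [k [count kq]] := quotient_count 0 nTm.
apply: (at_most_aligned dXP (k := k) (S := finset.set0) (J := AT) _ _ kq).
  by apply: gen; rewrite cards0 cAT.
move=> z Pz; exists (fun _ _ => 0); split=> [c a|//|j j' c cAT'].
  by rewrite normr0 ler01.
have zz := subvP V'PT _ (direction_sub PV (Pz j) (Pz j')).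
have := coordinate_spanP _ _ zz c cAT'; rewrite !mxE => ->.
by rewrite big1 // => a _; rewrite mul0r.
Qed.
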